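(* Let $k$ be a field, $G=\mathrm{GL}_4\times\mathrm{GL}_2\times\mathrm{GL}_2$, $W=\mathbb{A}^4$, $V=W\otimes L_1\oplus\wedge^2W\otimes L_2$, where $L_1=\mathbb{A}^2$ (resp. $L_2=\mathbb{A}^2$) is the standard representation of the first (resp. second) $\mathrm{GL}_2$ factor, with the natural action of $G$. For $x\in V$ let $B(x)\in\wedge^2W\otimes L_2$ be its second component, and let $U=\{x\in V\mid P_1(x)\neq0,\ P_2(x)\neq0\}$ with $P_1,P_2$ as defined in the context. Then the map $U_k\ni x\mapsto B(x)\in\wedge^2W\otimes L_2$ induces a bijection $$G_k\backslash U_k\cong(\mathrm{GL}_4(k)\times\mathrm{GL}_2(k))\backslash(\wedge^2W\otimes L_2)^{\mathrm{ss}}_k\cong\mathrm{Ex}_2(k).$$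
   Context: $\mathrm{Ex}_2(k)$ is the set of conjugacy classes of homomorphisms $\mathrm{Gal}(k^{\mathrm{sep}}/k)\to\mathfrak{S}_2$, i.e. the set of $k$-isomorphism classes of separable extensions of $k$ of degree at most $2$. $P_2$: for $x\in V$ regard $B(x)=(B_1,B_2)$ as a pair of $4\times4$ alternating matrices; $P_2(x)$ is the discriminant of the binary quadratic form $F(v)=\mathrm{Pfaff}(v_1B_1+v_2B_2)$ in $v=(v_1,v_2)$. $(\wedge^2W\otimes L_2)^{\mathrm{ss}}$ is the set where this discriminant is non-zero, and the second bijection associates to an orbit the field generated over $k$ by the roots of $F(v)$. $P_1$: let $\Phi_1:V\to W^*\otimes L_1\otimes L_2$ be the map, linear in each of $W\otimes L_1$ and $\wedge^2W\otimes L_2$, with $\Phi_1(b_1\otimes c_1,b_2\otimes c_2)=(b_1\wedge b_2)\otimes c_1\otimes c_2\in\wedge^3W\otimes L_1\otimes L_2\cong W^*\otimes L_1\otimes L_2$, where, for the standard basis $p_1,\dots,p_4$ of $W$ with dual basis $p_1^*,\dots,p_4^*$, the elements $p_2\wedge p_3\wedge p_4$, $p_1\wedge p_3\wedge p_4$, $p_1\wedge p_2\wedge p_4$, $p_1\wedge p_2\wedge p_3$ are identified with $p_1^*,-p_2^*,p_3^*,-p_4^*$. Regarding $\Phi_1(x)$ as a $2\times2$ matrix (indexed by bases of $L_1$, $L_2$) with entries linear forms in $u_i=p_i^*$, its determinant is a quadratic form in $u=(u_1,\dots,u_4)$, and $P_1(x)$ is the discriminant of this quaternary quadratic form (the determinant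 of the matrix of its polar bilinear form, so that $u_1u_4-u_2u_3$ has discriminant $1$). *)

(* Defs.v *)
From mathcomp Require Import all_boot all_algebra all_field.
From mathcomp Require Import boolp classical_sets functions.

Set Implicit Arguments.
Unset Strict Implicit.
Unset Printing Implicit Defensive.

Import GRing.Theory.
Local Open Scope classical_set_scope.
Local Open Scope ring_scope.

(** Quadratic forms on k^n are represented by the maps 'rV_n -> k that they
    define; over any field (finite ones included) the coefficients of a
    quadratic form are recovered from its values, as in [polar]. *)
Section QuadraticForms.
Variable k : fieldType.

Definition basis_row n (i : 'I_n) : 'rV[k]_n := delta_mx 0 i.

Definition polar n (q : 'rV[k]_n -> k) (u v : 'rV[k]_n) : k :=
  q (u + v) - q u - q v.

(* For q = a v1^2 + b v1 v2 + c v2^2 this is b^2 - 4 a c. *)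
Definition binary_disc (q : 'rV[k]_2 -> k) : k :=
  polar q (basis_row 0) (basis_row 1) ^+ 2
    - 4%:R * q (basis_row 0) * q (basis_row 1).

Definition quaternary_disc (q : 'rV[k]_4 -> k) : k :=
  \det (\matrix_(i, j) polar q (basis_row i) (basis_row j)).

(* q(X, 1) = a X^2 + b X + c. Its roots are the roots (t : 1) of q in the
   projective line; the only other possible root, (1 : 0), is rational over k
   and contributes nothing to the field generated by the roots. *)
Definition dehomogenize (q : 'rV[k]_2 -> k) : {poly k} :=
  q (basis_row 0) *: 'X^2
    + polar q (basis_row 0) (basis_row 1) *: 'X + (q (basis_row 1))%:P.

Definition generated_by_roots (q : 'rV[k]_2 -> k) (L : fieldExtType k) : Prop :=
  splittingFieldFor 1%VS (map_poly (in_alg L) (dehomogenize q)) {:L}%VS.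

End QuadraticForms.

Section Representation.
Variable k : fieldType.

(* The condition on the diagonal is not redundant in characteristic 2. *)
Definition alternating n (M : 'M[k]_n) : Prop :=
  M^T = - M /\ forall i, M i i = 0.

(** An element of W (x) L_1 is the 4 x 2 matrix of its coordinates. An element
    of /\^2 W (x) L_2 is a pair of alternating matrices, an element
    \sum_(i < j) m_ij p_i /\ p_j of /\^2 W being the alternating matrix whose
    (i, j) entry is m_ij for i < j. These spaces are the subsets [Lam2L2] and
    [V] of the following types. *)
Definition pairT : Type := {ffun 'I_2 -> 'M[k]_4}.
Definition VT : Type := ('M[k]_(4, 2) * pairT)%type.

Definition Lam2L2 : set pairT := [set b | forall i, alternating (b i)].
Definition V : set VT := [set x | Lam2L2 x.2].

Definition act_W_L1 (g : 'M[k]_4) (h : 'M[k]_2) (a : 'M[k]_(4, 2)) :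
  'M[k]_(4, 2) := g *m a *m h^T.

(* g sends p /\ q to gp /\ gq, that is M to g M g^T. *)
Definition act_Lam2_L2 (g : 'M[k]_4) (h : 'M[k]_2) (b : pairT) : pairT :=
  [ffun i => \sum_j h i j *: (g *m b j *m g^T)].

Definition orbit_V (x : VT) : set VT :=
  [set y | exists g h1 h2, [/\ g \in unitmx, h1 \in unitmx, h2 \in unitmx &
    y = (act_W_L1 g h1 x.1, act_Lam2_L2 g h2 x.2)]].

Definition orbit_Lam2L2 (b : pairT) : set pairT :=
  [set c | exists g h, [/\ g \in unitmx, h \in unitmx & c = act_Lam2_L2 g h b]].

Definition Pfaffian (M : 'M[k]_4) : k :=
  M 0 1 * M 2 3 - M 0 2 * M 1 3 + M 0 3 * M 1 2.

Definition pfaffian_form (b : pairT) (v : 'rV[k]_2) : k :=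
  Pfaffian (\sum_i v 0 i *: b i).

Definition P2 (b : pairT) : k := binary_disc (pfaffian_form b).

(* The coefficient of p_i /\ p_j /\ p_l, for i < j < l, in w /\ m. *)
Definition wedge3 (w : 'cV[k]_4) (m : 'M[k]_4) (i j l : 'I_4) : k :=
  w i 0 * m j l - w j 0 * m i l + w l 0 * m i j.

(* The image of w /\ m under the isomorphism of /\^3 W with the dual of W, as
   the row of its coordinates on the dual basis: the indices
   lift s 0 < lift s 1 < lift s 2 are those different from s, and the wedge of
   the corresponding basis vectors is identified with (-1)^s p_s^* (s counted
   from 0). *)
Definition wedge_dual (w : 'cV[k]_4) (m : 'M[k]_4) : 'rV[k]_4 :=
  \row_s ((-1) ^+ s * wedge3 w m (@lift 4 s 0) (@lift 4 s 1) (@lift 4 s 2)).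

Definition Phi1 (x : VT) (i j : 'I_2) : 'rV[k]_4 :=
  wedge_dual (col i x.1) (x.2 j).

Definition Phi1_form (x : VT) (u : 'rV[k]_4) : k :=
  \det (\matrix_(i < 2, j < 2) \sum_s Phi1 x i j 0 s * u 0 s).

Definition P1 (x : VT) : k := quaternary_disc (Phi1_form x).

Definition U : set VT := [set x | [/\ V x, P1 x != 0 & P2 x.2 != 0]].

Definition Lam2L2_ss : set pairT := [set b | Lam2L2 b /\ P2 b != 0].

Definition U_orbits : set (set VT) := orbit_V @` U.

Definition ss_orbits : set (set pairT) := orbit_Lam2L2 @` Lam2L2_ss.

Definition ext_isom (L L' : fieldExtType k) : Prop :=
  exists f : {lrmorphism L -> L'}, bijective f.

Definition separable_le2 (L : fieldExtType k) : Prop :=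
  separable 1%VS {:L}%VS /\ (\dim {:L}%VS <= 2)%N.

(* The isomorphism classes are predicates and not [set]s for universe reasons:
   the universe of [set] is too small to contain [fieldExtType k]. *)
Definition ext_class : Type := fieldExtType k -> Prop.

Definition Ex2 (C : ext_class) : Prop :=
  exists2 L, separable_le2 L & C = ext_isom L.

(* On an orbit of U this takes the value orbit_Lam2L2 x.2 for x in the orbit. *)
Definition B_orbit (O : set VT) : set pairT := [set x.2 | x in O].

(* The class of the fields generated over k by the roots of F, for the elements
   of the orbit O. *)
Definition root_field_class (O : set pairT) : ext_class :=
  fun L => exists2 b, O b & generated_by_roots (pfaffian_form b) L.

End Representation.

(* [set_bij], for types in arbitrary universes. *)
Definition bij_on (S T : Type) (A : S -> Prop) (B : T -> Prop) (f : S -> T) :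
    Prop :=
  [/\ forall x, A x -> B (f x),
      forall x y, A x -> A y -> f x = f y -> x = y &
      forall y, B y -> exists2 x, A x & f x = y].

(* Main.v *)
Require Import Defs.
From HB Require Import structures.
From mathcomp Require Import all_boot all_algebra all_field.
From mathcomp Require Import boolp classical_sets functions.
From mathcomp Require Import ring.

Set Implicit Arguments.
Unset Strict Implicit.
Unset Printing Implicit Defensive.

Import GRing.Theory.
Local Open Scope ring_scope.

(** To x = (a, b), with a the 4 x 2 matrix of w_1, w_2 and b = (B_1, B_2),
    attach the binary form F = al v_1^2 + be v_1 v_2 + ga v_2^2 of b and the
    pair s_j = w_1 /\ w_2 /\ B_j (up to sign). The four linear forms Phi_1(x)
    are the rows of a 4 x 4 matrix, the frame of x; P_1(x) is the square of its
    determinant, which is - (al s_2^2 - be s_1 s_2 + ga s_1^2). Moving x by its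
    frame yields a point all of whose coordinates are polynomials in (F, s), so
    two points of U with the same (F, s) lie in the same orbit. As G acts on
    (F, s) through determinants and through the second GL_2, every point of U
    can be moved to one with s = (0, 1) and F = v_1^2 + be v_1 v_2 + ga v_2^2;
    the remaining freedom is the substitution of c X + e for X in the
    polynomial X^2 + be X + ga, and this identifies two separable polynomials
    exactly when their roots generate the same field. Every semistable b is
    the second component of a point of U because otherwise
    al s_2^2 - be s_1 s_2 + ga s_1^2 would vanish on all decomposable
    bivectors, forcing the discriminant to be 0. *)

(** * Determinants of small order *)

(** Entries are indexed by naturals so that the [bump]s coming from the minors compute. *)
Lemma det2E (R : comNzRingType) (a : nat -> nat -> R) :
  \det (\matrix_(i < 2, j < 2) a i j) =
    a 0%N 0%N * a 1%N 1%N - a 0%N 1%N * a 1%N 0%N.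
Proof.
rewrite (expand_det_row _ ord0) !big_ord_recl big_ord0 /cofactor !det_mx11 !mxE.
by rewrite /= /bump /= !add0n !addn0; ring.
Qed.

Lemma det_mx22 (R : comNzRingType) (A : 'M[R]_2) :
  \det A = A 0 0 * A 1 1 - A 0 1 * A 1 0.
Proof.
pose a i j := A (inord i) (inord j).
have -> : A = \matrix_(i, j) a i j.
  by apply/matrixP=> i j; rewrite mxE /a !inord_val.
by rewrite det2E !mxE.
Qed.

Lemma det3E (R : comNzRingType) (a : nat -> nat -> R) :
  \det (\matrix_(i < 3, j < 3) a i j) =
    a 0%N 0%N * (a 1%N 1%N * a 2%N 2%N - a 1%N 2%N * a 2%N 1%N)
  - a 0%N 1%N * (a 1%N 0%N * a 2%N 2%N - a 1%N 2%N * a 2%N 0%N)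
  + a 0%N 2%N * (a 1%N 0%N * a 2%N 1%N - a 1%N 1%N * a 2%N 0%N).
Proof.
have E j : \det (row' ord0 (col' j (\matrix_(i < 3, j < 3) a i j))) =
    \det (\matrix_(i < 2, l < 2) a (bump 0 i) (bump j l)).
  by congr (\det _); apply/matrixP=> i l; rewrite !mxE.
rewrite (expand_det_row _ ord0) !big_ord_recl big_ord0 /cofactor !E.
rewrite !(det2E (fun i l => a (bump 0 i) (bump _ l))) !mxE.
by rewrite /= /bump /= !add0n; ring.
Qed.

(** The right-hand side is the Laplace expansion along the first two rows. *)
Lemma det4E (R : comNzRingType) (a : nat -> nat -> R) :
  \det (\matrix_(i < 4, j < 4) a i j) =
    (a 0%N 0%N * a 1%N 1%N - a 0%N 1%N * a 1%N 0%N)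
    * (a 2%N 2%N * a 3%N 3%N - a 2%N 3%N * a 3%N 2%N)
  - (a 0%N 0%N * a 1%N 2%N - a 0%N 2%N * a 1%N 0%N)
    * (a 2%N 1%N * a 3%N 3%N - a 2%N 3%N * a 3%N 1%N)
  + (a 0%N 0%N * a 1%N 3%N - a 0%N 3%N * a 1%N 0%N)
    * (a 2%N 1%N * a 3%N 2%N - a 2%N 2%N * a 3%N 1%N)
  + (a 0%N 1%N * a 1%N 2%N - a 0%N 2%N * a 1%N 1%N)
    * (a 2%N 0%N * a 3%N 3%N - a 2%N 3%N * a 3%N 0%N)
  - (a 0%N 1%N * a 1%N 3%N - a 0%N 3%N * a 1%N 1%N)
    * (a 2%N 0%N * a 3%N 2%N - a 2%N 2%N * a 3%N 0%N)
  + (a 0%N 2%N * a 1%N 3%N - a 0%N 3%N * a 1%N 2%N)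
    * (a 2%N 0%N * a 3%N 1%N - a 2%N 1%N * a 3%N 0%N).
Proof.
have E j : \det (row' ord0 (col' j (\matrix_(i < 4, j < 4) a i j))) =
    \det (\matrix_(i < 3, l < 3) a (bump 0 i) (bump j l)).
  by congr (\det _); apply/matrixP=> i l; rewrite !mxE.
rewrite (expand_det_row _ ord0) !big_ord_recl big_ord0 /cofactor !E.
rewrite !(det3E (fun i l => a (bump 0 i) (bump _ l))) !mxE.
by rewrite /= /bump /= !add0n; ring.
Qed.

(** * Alternating matrices and the frame of a point *)

Definition binary_form (R : fieldType) (a b c x y : R) :=
  a * x ^+ 2 + b * (x * y) + c * y ^+ 2.

Section Frame.
Variable k : fieldType.
Implicit Types (M N : 'M[k]_4).

Definition skew4 (m01 m02 m03 m12 m13 m23 : k) : 'M[k]_4 :=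
  \matrix_(i, j) nth 0 (nth [::] [::
    [:: 0; m01; m02; m03]; [:: - m01; 0; m12; m13];
    [:: - m02; - m12; 0; m23]; [:: - m03; - m13; - m23; 0]] i) j.

(* The Hodge star: u |-> u^T *m star M is the wedge product with M followed by
   the identification of /\^3 W with the dual of W, see [wedge_dualE]. *)
Definition star M : 'M[k]_4 :=
  skew4 (- M 2 3) (M 1 3) (- M 1 2) (- M 0 3) (M 0 2) (- M 0 1).

Lemma skew4E a b c d e f i j : skew4 a b c d e f i j =
  nth 0 (nth [::] [:: [:: 0; a; b; c]; [:: - a; 0; d; e];
                      [:: - b; - d; 0; f]; [:: - c; - e; - f; 0]] i) j.
Proof. by rewrite mxE. Qed.

Lemma star_skew4 a b c d e f :
  star (skew4 a b c d e f) = skew4 (- f) e (- d) (- c) b (- a).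
Proof. by rewrite /star !skew4E. Qed.

(** On bivectors this is the wedge product /\^2 W x /\^2 W -> /\^4 W = k. *)
Definition pfpolar M N : k := Pfaffian (M + N) - Pfaffian M - Pfaffian N.

Lemma ord4P (P : 'I_4 -> Prop) : P 0 -> P 1 -> P 2 -> P 3 -> forall i, P i.
Proof.
move=> P0 P1 P2 P3 [[|[|[|[|//]]]] lti].
- by rewrite (_ : Ordinal lti = 0) //; apply: val_inj.
- by rewrite (_ : Ordinal lti = 1) //; apply: val_inj.
- by rewrite (_ : Ordinal lti = 2) //; apply: val_inj.
- by rewrite (_ : Ordinal lti = 3) //; apply: val_inj.
Qed.

Lemma sum4E (F : 'I_4 -> k) : \sum_i F i = F 0 + F 1 + F 2 + F 3.
Proof.
rewrite !big_ord_recl big_ord0 addr0 !addrA.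
by congr (F _ + F _ + F _ + F _); apply: val_inj.
Qed.

Lemma ord2P (P : 'I_2 -> Prop) : P 0 -> P 1 -> forall i, P i.
Proof.
move=> P0 P1 [[|[|//]] lti].
- by rewrite (_ : Ordinal lti = 0) //; apply: val_inj.
- by rewrite (_ : Ordinal lti = 1) //; apply: val_inj.
Qed.

Lemma sum2E (V : nmodType) (F : 'I_2 -> V) : \sum_i F i = F 0 + F 1.
Proof.
rewrite !big_ord_recl big_ord0 addr0.
by congr (F _ + F _); apply: val_inj.
Qed.

Lemma skew4_alternating a b c d e f : alternating (skew4 a b c d e f).
Proof.
split; last by elim/ord4P; rewrite mxE.
by apply/matrixP=> i j; elim/ord4P: i; elim/ord4P: j; rewrite !mxE /= ?oppr0 ?opprK.
Qed.

Variant alternating_spec : 'M[k]_4 -> Prop :=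
  AlternatingSpec a b c d e f : alternating_spec (skew4 a b c d e f).

Lemma alternatingP M : alternating M -> alternating_spec M.
Proof.
case=> MT M0.
have Mt i j : M i j = - M j i by move/matrixP: MT => /(_ j i); rewrite !mxE.
suff -> : M = skew4 (M 0 1) (M 0 2) (M 0 3) (M 1 2) (M 1 3) (M 2 3) by [].
by apply/matrixP=> i j; elim/ord4P: i; elim/ord4P: j; rewrite !mxE /= -?Mt.
Qed.

Lemma alternatingD n (M N : 'M[k]_n) :
  alternating M -> alternating N -> alternating (M + N).
Proof.
move=> [MT M0] [NT N0]; split=> [|i]; first by rewrite linearD /= MT NT opprD.
by rewrite mxE M0 N0 addr0.
Qed.

Lemma alternatingZ n c (M : 'M[k]_n) : alternating M -> alternating (c *: M).
Proof.
move=> [MT M0]; split=> [|i]; first by rewrite linearZ /= MT scalerN.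
by rewrite mxE M0 mulr0.
Qed.

(** In characteristic 2 antisymmetry says nothing about the diagonal. There the double sum is split:
    terms with equal indices vanish, and the terms at (a, b) and (b, a) cancel. *)
Lemma alternating_cong m n (g : 'M[k]_(m, n)) (M : 'M[k]_n) :
  alternating M -> alternating (g *m M *m g^T).
Proof.
move=> [MT M0]; split=> [|i].
  by rewrite !trmx_mul trmxK MT mulNmx mulmxN mulmxA.
have Mt i1 j1 : M i1 j1 = - M j1 i1 by move/matrixP: MT => /(_ j1 i1); rewrite !mxE.
rewrite mxE; under eq_bigr => j _ do rewrite !mxE mulr_suml.
rewrite pair_big /= (bigID (fun p : 'I_n * 'I_n => p.1 == p.2)) /= big1 ?add0r; last first.
  by move=> [a b] /= /eqP->; rewrite M0 mulr0 mul0r.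
rewrite (bigID (fun p : 'I_n * 'I_n => p.1 < p.2)%N) /=.
rewrite [X in _ + X](reindex_inj (h := fun p : 'I_n * 'I_n => (p.2, p.1))) /=; last first.
  by move=> [a b] [c d] [-> ->].
rewrite [X in X + _](eq_bigl (fun p : 'I_n * 'I_n => (p.1 < p.2)%N)); last first.
  by move=> [a b] /=; rewrite andbC; case: ltngtP => //= h; apply/eqP=> E; rewrite E ltnn in h.
rewrite [X in _ + X](eq_bigl (fun p : 'I_n * 'I_n => (p.1 < p.2)%N)); last first.
  move=> [a b] /=; rewrite -leqNgt -val_eqE /=; by case: ltngtP.
by rewrite -big_split big1 // => -[a b] _ /=; rewrite (Mt b a); ring.
Qed.

Lemma starD M N : star (M + N) = star M + star N.
Proof.
apply/matrixP=> i j.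
by elim/ord4P: i; elim/ord4P: j; rewrite !mxE /= ?addr0 ?opprD ?opprK.
Qed.

Lemma star_alternating M : alternating (star M).
Proof. exact: skew4_alternating. Qed.

(** Up to sign conventions [star M] is the Pfaffian adjugate of M. *)
Lemma star_mul M : alternating M -> star M *m M = (Pfaffian M)%:M.
Proof.
case/alternatingP=> a b c d e f; rewrite star_skew4 /Pfaffian !skew4E /=.
apply/matrixP=> i j; rewrite mxE [RHS]mxE sum4E !skew4E.
by elim/ord4P: i; elim/ord4P: j => /=; ring.
Qed.

Lemma mul_star M : alternating M -> M *m star M = (Pfaffian M)%:M.
Proof.
move=> aM; rewrite -tr_scalar_mx -star_mul // trmx_mul.
by rewrite aM.1 (star_alternating M).1 mulNmx mulmxN opprK.
Qed.

Lemma wedge_dualE (w : 'cV[k]_4) M : alternating M -> wedge_dual w M = w^T *m star M.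
Proof.
case/alternatingP=> a b c d e f; apply/matrixP=> i j; rewrite ord1 !mxE sum4E.
rewrite /wedge3.
have l0 s : @lift 4 s 0 = if s == 0 then 1 else 0.
  by elim/ord4P: s; apply: val_inj.
have l1 s : @lift 4 s 1 = if (s < 2)%N then 2 else 1.
  by elim/ord4P: s; apply: val_inj.
have l2 s : @lift 4 s 2 = if s == 3 then 2 else 3.
  by elim/ord4P: s; apply: val_inj.
rewrite l0 l1 l2; move: (w 0 0) (w 1 0) (w 2 0) (w 3 0) => w0 w1 w2 w3.
by elim/ord4P: j; rewrite /= !mxE /=; ring.
Qed.

(** A polynomial identity in the entries, valid for singular g too; [det_frame] applies it to a
    frame not yet known to be invertible. *)
Lemma Pfaffian_cong (g : 'M[k]_4) M :
  alternating M -> Pfaffian (g *m M *m g^T) = \det g * Pfaffian M.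
Proof.
case/alternatingP=> m01 m02 m03 m12 m13 m23.
pose a i j := g (inord i) (inord j).
have -> : g = \matrix_(i, j) a i j by apply/matrixP=> i j; rewrite mxE /a !inord_val.
rewrite det4E /Pfaffian; move: a => a; rewrite !mxE !sum4E !mxE !sum4E !mxE /=.
move: (a 0%N 0%N) (a 0%N 1%N) (a 0%N 2%N) (a 0%N 3%N) => a00 a01 a02 a03.
move: (a 1%N 0%N) (a 1%N 1%N) (a 1%N 2%N) (a 1%N 3%N) => a10 a11 a12 a13.
move: (a 2%N 0%N) (a 2%N 1%N) (a 2%N 2%N) (a 2%N 3%N) => a20 a21 a22 a23.
move: (a 3%N 0%N) (a 3%N 1%N) (a 3%N 2%N) (a 3%N 3%N) => a30 a31 a32 a33.
ring.
Qed.


Implicit Types (X Y : 'M[k]_4) (b : pairT k) (x y : VT k).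

Definition skew2 : 'M[k]_2 := delta_mx 0 1 - delta_mx 1 0.

Lemma alternating2E (M : 'M[k]_2) : alternating M -> M = M 0 1 *: skew2.
Proof.
case=> MT M0; have M10 : M 1 0 = - M 0 1 by move/matrixP: MT => /(_ 0 1); rewrite !mxE.
apply/matrixP=> i j; elim/ord2P: i; elim/ord2P: j; rewrite !mxE /= ?M0 ?M10; ring.
Qed.

Lemma cong_skew2 (h : 'M[k]_2) : h^T *m skew2 *m h = \det h *: skew2.
Proof.
rewrite det_mx22; apply/matrixP=> i j.
by elim/ord2P: i; elim/ord2P: j; rewrite !mxE !sum2E !mxE !sum2E !mxE /=; ring.
Qed.

Lemma PfaffianD X Y c d :
  Pfaffian (c *: X + d *: Y) =
  binary_form (Pfaffian X) (pfpolar X Y) (Pfaffian Y) c d.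
Proof. by rewrite /binary_form /pfpolar /Pfaffian !mxE; ring. Qed.

Lemma pfpolarC X Y : pfpolar X Y = pfpolar Y X.
Proof. by rewrite /pfpolar (addrC X) addrAC. Qed.

Lemma pfpolar_cong (g : 'M[k]_4) X Y : alternating X -> alternating Y ->
  pfpolar (g *m X *m g^T) (g *m Y *m g^T) = \det g * pfpolar X Y.
Proof.
move=> aX aY; rewrite /pfpolar -mulmxDl -mulmxDr !Pfaffian_cong //.
  by ring.
exact: alternatingD.
Qed.

Lemma star_polar X Y : alternating X -> alternating Y ->
  star X *m Y + star Y *m X = (pfpolar X Y)%:M.
Proof.
move=> aX aY; rewrite /pfpolar !raddfB /= -!star_mul //; last exact: alternatingD.
rewrite starD mulmxDl !mulmxDr.
move: (star X *m X) (star X *m Y) (star Y *m X) (star Y *m Y) => A B C D.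
by apply/matrixP=> i j; rewrite !mxE; ring.
Qed.

(** Multiply [star_polar] on the right by [star X] and use that X times [star X] is scalar. *)
Lemma star_sandwich X Y : alternating X -> alternating Y ->
  star X *m Y *m star X = pfpolar X Y *: star X - Pfaffian X *: star Y.
Proof.
move=> aX aY; have /(canRL (addrK _)) -> := star_polar aX aY.
by rewrite mulmxBl mul_scalar_mx -mulmxA mul_star // mul_mx_scalar.
Qed.

(* Up to sign, the coefficient of w_1 /\ w_2 /\ B_j, see [sgE]. *)
Definition sg x (j : 'I_2) : k := (x.1^T *m star (x.2 j) *m x.1) 0 1.

Lemma cong_star x j : x.1^T *m star (x.2 j) *m x.1 = sg x j *: skew2.
Proof.
apply: alternating2E; rewrite -{2}[x.1]trmxK; apply: alternating_cong.
exact: star_alternating.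
Qed.

Lemma addmxE m n (A B : 'M[k]_(m, n)) i j : (A + B) i j = A i j + B i j.
Proof. by rewrite mxE. Qed.

Lemma scalemxE m n c (A : 'M[k]_(m, n)) i j : (c *: A) i j = c * A i j.
Proof. by rewrite mxE. Qed.

(** The matrix paired with [x.2 j] is the bivector w_1 /\ w_2, so the action on [sg] can be read off
    from [pfpolar_cong]. *)
Lemma sgE x j : alternating (x.2 j) ->
  sg x j = - pfpolar (x.2 j) (x.1 *m skew2 *m x.1^T).
Proof.
have E p q : (x.1 *m skew2 *m x.1^T) p q = x.1 p 0 * x.1 q 1 - x.1 p 1 * x.1 q 0.
  by rewrite !mxE !sum2E !mxE !sum2E !mxE /=; ring.
rewrite /sg; case/alternatingP=> m01 m02 m03 m12 m13 m23.
rewrite /pfpolar /Pfaffian !addmxE !E.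
rewrite star_skew4 mxE sum4E ![(_^T *m _) _ _]mxE !sum4E.
have T p q : (x.1^T) p q = x.1 q p by rewrite mxE.
rewrite !T !skew4E /= {E T}.
move: (x.1 0 0) (x.1 1 0) (x.1 2 0) (x.1 3 0) => a0 a1 a2 a3.
move: (x.1 0 1) (x.1 1 1) (x.1 2 1) (x.1 3 1) => c0 c1 c2 c3.
by ring.
Qed.

(* The rows are the linear forms Phi1 x 0 0, Phi1 x 1 0, Phi1 x 0 1 and
   Phi1 x 1 1. *)
Definition frame x : 'M[k]_(2 + 2, 4) :=
  col_mx (x.1^T *m star (x.2 0)) (x.1^T *m star (x.2 1)).

Lemma frame_mul x : frame x *m x.1 = col_mx (sg x 0 *: skew2) (sg x 1 *: skew2).
Proof. by rewrite /frame mul_col_mx !cong_star. Qed.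

(** Block (i, j) is minus the compression by [x.1] of [star (x.2 i) *m x.2 m *m star (x.2 j)], which
    [star_mul], [mul_star] and [star_sandwich] turn into a combination of [star (x.2 0)] and
    [star (x.2 1)]. *)
Definition frame_blocks (al be ga s0 s1 : k) (m : 'I_2) : 'M[k]_(2 + 2) :=
  if m == 0 then
    block_mx (- (al * s0) *: skew2) (- (al * s1) *: skew2)
             (- (al * s1) *: skew2) ((ga * s0 - be * s1) *: skew2)
  else
    block_mx ((al * s1 - be * s0) *: skew2) (- (ga * s0) *: skew2)
             (- (ga * s0) *: skew2) (- (ga * s1) *: skew2).

Definition pf_al b := Pfaffian (b 0).
Definition pf_be b := pfpolar (b 0) (b 1).
Definition pf_ga b := Pfaffian (b 1).

Lemma frame_cong x m : Lam2L2 x.2 ->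
  frame x *m x.2 m *m (frame x)^T =
  frame_blocks (pf_al x.2) (pf_be x.2) (pf_ga x.2) (sg x 0) (sg x 1) m.
Proof.
move=> ax; pose c X := x.1^T *m X *m x.1.
have cE j : c (star (x.2 j)) = sg x j *: skew2 := cong_star x j.
have cD X Y : c (X + Y) = c X + c Y by rewrite /c mulmxDr mulmxDl.
have cN X : c (- X) = - c X by rewrite /c mulmxN mulNmx.
have cZ d X : c (d *: X) = d *: c X by rewrite /c -scalemxAr -scalemxAl.
rewrite /frame mul_col_mx (tr_col_mx (_ *m _)) mul_col_row !trmx_mul !trmxK.
rewrite !(star_alternating _).1 !mulNmx !mulmxN !mulmxA.
have E i j : x.1^T *m star (x.2 i) *m x.2 m *m star (x.2 j) *m x.1 =
    c (star (x.2 i) *m x.2 m *m star (x.2 j)) by rewrite /c !mulmxA.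
rewrite !E; elim/ord2P: m {E}; rewrite /frame_blocks /=; congr block_mx.
all: rewrite ?star_mul // -?[_ *m star _]mulmxA ?mul_star // ?mulmxA.
all: rewrite ?star_sandwich // ?mul_scalar_mx ?mul_mx_scalar ?(cD, cN, cZ, cE) //.
all: rewrite /pf_al /pf_be /pf_ga ?(pfpolarC (x.2 1)).
all: by move: skew2 => J; apply/matrixP=> i j; rewrite !mxE; ring.
Qed.

Lemma Pfaffian_blocks (A : 'M[k]_(2 + 2)) :
  Pfaffian (A : 'M_4) =
    A (lshift 2 0) (lshift 2 1) * A (rshift 2 0) (rshift 2 1)
    - A (lshift 2 0) (rshift 2 0) * A (lshift 2 1) (rshift 2 1)
    + A (lshift 2 0) (rshift 2 1) * A (lshift 2 1) (rshift 2 0).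
Proof.
by rewrite /Pfaffian; congr (_ * _ - _ * _ + _ * _); congr (A _ _); apply: val_inj.
Qed.

Lemma Pfaffian_frame_blocks al be ga s0 s1 c d :
  Pfaffian (c *: frame_blocks al be ga s0 s1 0 + d *: frame_blocks al be ga s0 s1 1)
   = - binary_form al be ga c d *
     (al * s1 ^+ 2 - be * (s0 * s1) + ga * s0 ^+ 2).
Proof.
rewrite Pfaffian_blocks /frame_blocks /= !addmxE !scalemxE.
rewrite !(block_mxEul, block_mxEur, block_mxEdl, block_mxEdr) !scalemxE !mxE /=.
by rewrite /binary_form; ring.
Qed.

Lemma pfaffian_formE b v :
  pfaffian_form b v =
    binary_form (pf_al b) (pf_be b) (pf_ga b) (v 0 0) (v 0 1).
Proof. by rewrite /pfaffian_form sum2E PfaffianD. Qed.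

Lemma binary_formE (q : 'rV[k]_2 -> k) al be ga :
  (forall v, q v = binary_form al be ga (v 0 0) (v 0 1)) ->
  [/\ q (basis_row k 0) = al, polar q (basis_row k 0) (basis_row k 1) = be
    & q (basis_row k 1) = ga].
Proof. by move=> qE; rewrite /polar !qE /binary_form !mxE /=; split; ring. Qed.

Lemma P2E b : P2 b = pf_be b ^+ 2 - 4%:R * pf_al b * pf_ga b.
Proof.
by rewrite /P2 /binary_disc; have [-> -> ->] := binary_formE (pfaffian_formE b).
Qed.

(** This is F evaluated at (s_1, - s_0), where s_j is [sg x j]. *)
Definition pf_dual x :=
  pf_al x.2 * sg x 1 ^+ 2 - pf_be x.2 * (sg x 0 * sg x 1) + pf_ga x.2 * sg x 0 ^+ 2.

(** Take Pfaffians in [frame_cong] for c B_0 + d B_1: both sides acquire the factor F(c, d), which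
    can be cancelled at one of (1, 0), (0, 1), (1, 1), since otherwise all coefficients of F, and
    with them P_2, would vanish. *)
Lemma det_frame x : Lam2L2 x.2 -> P2 x.2 != 0 ->
  \det (frame x : 'M_4) = - pf_dual x.
Proof.
move=> ax; rewrite P2E => D0.
pose f := binary_form (pf_al x.2) (pf_be x.2) (pf_ga x.2).
have E c d : \det (frame x : 'M_4) * f c d = - pf_dual x * f c d.
  rewrite {1}/f -PfaffianD -Pfaffian_cong; last first.
    by apply: alternatingD; apply: alternatingZ.
  rewrite mulmxDr mulmxDl -!scalemxAr -!scalemxAl !frame_cong //.
  by rewrite Pfaffian_frame_blocks /pf_dual /f; ring.
have I c d : f c d != 0 -> \det (frame x : 'M_4) = - pf_dual x.
  by move=> nz; apply: (mulIf nz).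
apply: contraNeq D0 => nE.
have Z c d : f c d = 0 by apply/eqP; apply: contraNT nE => /I ->.
have := Z 1 0; have := Z 0 1; have := Z 1 1; rewrite /f /binary_form.
rewrite !(expr1n, expr0n, mulr1, mulr0, mul0r, addr0, add0r) /= => ABC C A.
by move: ABC; rewrite A C add0r addr0 => ->; rewrite mulr0 expr0n subr0.
Qed.

(** The form is y_0 y_3 - y_1 y_2 in the four linear forms y_i given by the rows of the frame. Its
    Gram matrix is therefore the transform by the frame of the Gram matrix [s] of that split form,
    which has determinant 1. *)
Lemma P1E x : Lam2L2 x.2 -> P1 x = \det (frame x : 'M_4) ^+ 2.
Proof.
move=> ax.
pose s : 'M[k]_4 := \matrix_(i, j) nth 0 (nth [::] [:: [:: 0; 0; 0; 1];
   [:: 0; 0; -1; 0]; [:: 0; -1; 0; 0]; [:: 1; 0; 0; 0]] i) j.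
have ds : \det s = 1 by rewrite /s (det4E (fun i j => nth 0 (nth [::] _ i) j)) /=; ring.
rewrite /P1 /quaternary_disc -[RHS]mulr1 -ds expr2 mulrAC -[X in X * _ * _]det_tr -!det_mulmx.
congr (\det _); apply/matrixP=> i j.
have e0 : (0 : 'I_4) = lshift 2 (0 : 'I_2) by apply: val_inj.
have e1 : (1 : 'I_4) = lshift 2 (1 : 'I_2) by apply: val_inj.
have e2 : (2 : 'I_4) = rshift 2 (0 : 'I_2) by apply: val_inj.
have e3 : (3 : 'I_4) = rshift 2 (1 : 'I_2) by apply: val_inj.
pose f (p q : 'I_2) := Phi1 x p q 0.
have fE p q l : (x.1^T *m star (x.2 q)) p l = f p q l.
  by rewrite /f /Phi1 wedge_dualE // !mxE; apply: eq_bigr => r _; rewrite !mxE.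
have FE l : [/\ frame x 0 l = f 0 0 l, frame x 1 l = f 1 0 l,
   frame x 2 l = f 0 1 l & frame x 3 l = f 1 1 l].
  by rewrite e3 e2 e1 e0 /frame !(col_mxEu, col_mxEd) !fE.
have QE u : Phi1_form x u =
    (\sum_l f 0 0 l * u 0 l) * (\sum_l f 1 1 l * u 0 l) -
    (\sum_l f 0 1 l * u 0 l) * (\sum_l f 1 0 l * u 0 l).
  by rewrite /Phi1_form det_mx22 !mxE.
have B a l : \sum_r f a l r * basis_row k i 0 r = f a l i.
  by rewrite (bigD1 i) //= big1 => [|r /negPf ri]; rewrite !mxE ?eqxx ?ri ?mulr1 ?addr0 ?mulr0.
have B' a l : \sum_r f a l r * basis_row k j 0 r = f a l j.
  by rewrite (bigD1 j) //= big1 => [|r /negPf ri]; rewrite !mxE ?eqxx ?ri ?mulr1 ?addr0 ?mulr0.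
have BD a l : \sum_r f a l r * (basis_row k i + basis_row k j) 0 r = f a l i + f a l j.
  by rewrite -B -B' -big_split; apply: eq_bigr => r _; rewrite addmxE mulrDr.
rewrite [LHS]mxE /polar !QE !BD !B !B'.
rewrite mxE sum4E; have [-> -> -> ->] := FE j.
rewrite ![(_ *m s) _ _]mxE !sum4E ![(frame x)^T _ _]mxE.
have [-> -> -> ->] := FE i.
by rewrite !mxE /=; ring.
Qed.

End Frame.

(** * The group action *)

Section Orbits.
Variable k : fieldType.
Implicit Types (g : 'M[k]_4) (h : 'M[k]_2) (b : pairT k) (x y : VT k).

Lemma act_W_L1_comp g g' h h' (a : 'M[k]_(4, 2)) :
  act_W_L1 g' h' (act_W_L1 g h a) = act_W_L1 (g' *m g) (h' *m h) a.
Proof. by rewrite /act_W_L1 trmx_mul !mulmxA. Qed.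

Lemma act_Lam2_L2_comp g g' h h' b :
  act_Lam2_L2 g' h' (act_Lam2_L2 g h b) = act_Lam2_L2 (g' *m g) (h' *m h) b.
Proof.
apply/ffunP=> i; rewrite !ffunE !sum2E !ffunE !sum2E !mxE !sum2E trmx_mul.
rewrite !(mulmxDl, mulmxDr) -!(scalemxAr, scalemxAl) !mulmxA.
move: (_ *m b 0 *m _ *m _) (_ *m b 1 *m _ *m _) => X Y.
rewrite -?scalemxAl; apply/matrixP=> p q; rewrite !mxE; ring.
Qed.

Lemma act_W_L1_1 (a : 'M[k]_(4, 2)) : act_W_L1 1%:M 1%:M a = a.
Proof. by rewrite /act_W_L1 trmx1 mulmx1 mul1mx. Qed.

Lemma act_Lam2_L2_1 b : act_Lam2_L2 1%:M 1%:M b = b.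
Proof.
apply/ffunP=> i; rewrite ffunE sum2E trmx1 !mul1mx !mulmx1.
by elim/ord2P: i; rewrite !mxE /= scale1r scale0r ?addr0 ?add0r.
Qed.

Lemma orbit_V_sym x y : orbit_V x y -> orbit_V y x.
Proof.
move=> [g [h1 [h2 [ug uh1 uh2 ->]]]].
exists (invmx g), (invmx h1), (invmx h2); split; rewrite ?unitmx_inv //=.
rewrite act_W_L1_comp act_Lam2_L2_comp !mulVmx // act_W_L1_1 act_Lam2_L2_1.
by case: x.
Qed.

Lemma orbit_V_trans x y z : orbit_V x y -> orbit_V y z -> orbit_V x z.
Proof.
move=> [g [h1 [h2 [ug uh1 uh2 ->]]]] [g' [h1' [h2' [ug' uh1' uh2' ->]]]].
exists (g' *m g), (h1' *m h1), (h2' *m h2); split; rewrite ?unitmx_mul ?ug' ?uh1' ?uh2' //=.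
by rewrite act_W_L1_comp act_Lam2_L2_comp.
Qed.

Lemma orbit_V_eq x y : orbit_V x y -> orbit_V x = orbit_V y.
Proof.
move=> xy; apply/seteqP; split=> z; last exact: orbit_V_trans.
by apply: orbit_V_trans; apply: orbit_V_sym.
Qed.

Lemma orbit_Lam2L2_refl b : orbit_Lam2L2 b b.
Proof. by exists 1%:M, 1%:M; split; rewrite ?unitmx1 // act_Lam2_L2_1. Qed.

Lemma orbit_Lam2L2_sym b c : orbit_Lam2L2 b c -> orbit_Lam2L2 c b.
Proof.
move=> [g [h [ug uh ->]]]; exists (invmx g), (invmx h); split; rewrite ?unitmx_inv //=.
by rewrite act_Lam2_L2_comp !mulVmx // act_Lam2_L2_1.
Qed.

Lemma orbit_Lam2L2_trans b c d :
  orbit_Lam2L2 b c -> orbit_Lam2L2 c d -> orbit_Lam2L2 b d.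
Proof.
move=> [g [h [ug uh ->]]] [g' [h' [ug' uh' ->]]].
by exists (g' *m g), (h' *m h); split; rewrite ?unitmx_mul ?ug' ?uh' ?act_Lam2_L2_comp.
Qed.

Lemma orbit_Lam2L2_eq b c : orbit_Lam2L2 b c -> orbit_Lam2L2 b = orbit_Lam2L2 c.
Proof.
move=> bc; apply/seteqP; split=> d; last exact: orbit_Lam2L2_trans.
by apply: orbit_Lam2L2_trans; apply: orbit_Lam2L2_sym.
Qed.

Lemma B_orbit_V x : B_orbit (orbit_V x) = orbit_Lam2L2 x.2.
Proof.
apply/seteqP; split=> [_ [_ [g [h1 [h2 [ug uh1 uh2 ->]]]] <-]|_ [g [h [ug uh ->]]]].
  by exists g, h2.
exists (act_W_L1 g 1%:M x.1, act_Lam2_L2 g h x.2) => //.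
by exists g, 1%:M, h; rewrite unitmx1.
Qed.

Lemma act_Lam2L2 g h b : Lam2L2 b -> Lam2L2 (act_Lam2_L2 g h b).
Proof.
move=> ab i; rewrite ffunE sum2E; apply: alternatingD.
  exact/alternatingZ/alternating_cong.
exact/alternatingZ/alternating_cong.
Qed.

(** * Transformation laws of F, of s and of the discriminants *)

Lemma Pfaffian_act g h b c d : Lam2L2 b ->
  Pfaffian (c *: act_Lam2_L2 g h b 0 + d *: act_Lam2_L2 g h b 1) =
  \det g * binary_form (pf_al b) (pf_be b) (pf_ga b)
    (c * h 0 0 + d * h 1 0) (c * h 0 1 + d * h 1 1).
Proof.
move=> ab; rewrite -PfaffianD -Pfaffian_cong; last first.
  by apply: alternatingD; apply: alternatingZ.
congr Pfaffian; rewrite !ffunE !sum2E mulmxDr mulmxDl -!(scalemxAr, scalemxAl).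
move: (g *m b 0 *m _) (g *m b 1 *m _) => X Y.
by apply/matrixP=> p q; rewrite !mxE; ring.
Qed.

Lemma pf_al_act g h b : Lam2L2 b -> pf_al (act_Lam2_L2 g h b) =
  \det g * binary_form (pf_al b) (pf_be b) (pf_ga b) (h 0 0) (h 0 1).
Proof.
move=> ab; have := Pfaffian_act g h 1 0 ab.
by rewrite scale1r scale0r !mul1r !mul0r !addr0.
Qed.

Lemma pf_ga_act g h b : Lam2L2 b -> pf_ga (act_Lam2_L2 g h b) =
  \det g * binary_form (pf_al b) (pf_be b) (pf_ga b) (h 1 0) (h 1 1).
Proof.
move=> ab; have := Pfaffian_act g h 0 1 ab.
by rewrite scale1r scale0r !mul1r !mul0r !add0r.
Qed.

Lemma pf_be_act g h b : Lam2L2 b -> pf_be (act_Lam2_L2 g h b) =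
  \det g * (2%:R * pf_al b * (h 0 0 * h 1 0) + pf_be b * (h 0 0 * h 1 1 + h 0 1 * h 1 0)
            + 2%:R * pf_ga b * (h 0 1 * h 1 1)).
Proof.
move=> ab; have := Pfaffian_act g h 1 1 ab; rewrite !scale1r.
move=> E; rewrite [LHS]/(pfpolar _ _) E.
rewrite -/(pf_al _) -/(pf_ga _) pf_al_act // pf_ga_act // /binary_form; ring.
Qed.

Lemma sg_act g h1 h2 x i : Lam2L2 x.2 ->
  sg (act_W_L1 g h1 x.1, act_Lam2_L2 g h2 x.2) i =
  \det g * \det h1 * (h2 i 0 * sg x 0 + h2 i 1 * sg x 1).
Proof.
move=> ax; rewrite !sgE //; last exact: act_Lam2L2.
rewrite /= /act_W_L1 !trmx_mul trmxK ffunE sum2E.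
(* The bivector w_1 /\ w_2 is moved by g and multiplied by [\det h1]. *)
have -> : g *m x.1 *m h1^T *m skew2 k *m (h1 *m (x.1^T *m g^T)) =
    \det h1 *: (g *m (x.1 *m skew2 k *m x.1^T) *m g^T).
  have -> : g *m x.1 *m h1^T *m skew2 k *m (h1 *m (x.1^T *m g^T)) =
      g *m x.1 *m (h1^T *m skew2 k *m h1) *m x.1^T *m g^T by rewrite !mulmxA.
  by rewrite cong_skew2 -!(scalemxAr, scalemxAl) !mulmxA -?scalemxAl.
rewrite pfpolarC; set N := g *m _ *m _.
have E M : pfpolar (\det h1 *: N) (g *m M *m g^T) = 
  \det h1 * pfpolar (g *m M *m g^T) N by rewrite /pfpolar /Pfaffian !mxE; ring.
have pZ c M M' : pfpolar M (c *: M') = c * pfpolar M M'.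
  by rewrite /pfpolar /Pfaffian !mxE; ring.
have pD M M' M'' : pfpolar M (M' + M'') = pfpolar M M' + pfpolar M M''.
  by rewrite /pfpolar /Pfaffian !mxE; ring.
have aN : alternating (x.1 *m skew2 k *m x.1^T).
  apply: alternating_cong; split=> [|j]; first by rewrite linearB /= !trmx_delta opprB.
  by elim/ord2P: j; rewrite !mxE subr0.
by rewrite pD !pZ !E /N !pfpolar_cong //; ring.
Qed.

Lemma P2_act g h b : Lam2L2 b ->
  P2 (act_Lam2_L2 g h b) = (\det g * \det h) ^+ 2 * P2 b.
Proof.
move=> ab; rewrite !P2E pf_al_act // pf_be_act // pf_ga_act // /binary_form.
by rewrite det_mx22; ring.
Qed.

Lemma pf_dual_act g h1 h2 x : Lam2L2 x.2 ->
  pf_dual (act_W_L1 g h1 x.1, act_Lam2_L2 g h2 x.2) =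
  \det g * (\det g * \det h1 * \det h2) ^+ 2 * pf_dual x.
Proof.
move=> ax; rewrite /pf_dual !sg_act // pf_al_act // pf_be_act // pf_ga_act //.
by rewrite /binary_form (det_mx22 h2); ring.
Qed.

(** Once P_2 is nonzero, P_1 is the square of [pf_dual x], by [P1E] and [det_frame]. *)
Lemma UE x : U x <-> [/\ Lam2L2 x.2, P2 x.2 != 0 & pf_dual x != 0].
Proof.
by split=> -[ax]; [rewrite P1E // => p q | move=> q p]; split=> //;
  move: p; rewrite ?P1E // det_frame // sqrf_eq0 oppr_eq0.
Qed.

Lemma U_act g h1 h2 x : g \in unitmx -> h1 \in unitmx -> h2 \in unitmx -> U x ->
  U (act_W_L1 g h1 x.1, act_Lam2_L2 g h2 x.2).
Proof.
rewrite !unitmxE !unitfE => ug uh1 uh2 /UE[ax p2 pd]; apply/UE; split=> /=.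
- exact: act_Lam2L2.
- by rewrite P2_act // mulf_neq0 // expf_neq0 // mulf_neq0.
- by rewrite pf_dual_act // ?(mulf_neq0, expf_neq0).
Qed.

(** * Standard points of U *)

Lemma exists_det n (d : k) : exists g : 'M[k]_n.+1, \det g = d.
Proof.
exists (diag_mx (\row_j if j == 0 then d else 1)).
by rewrite det_diag (bigD1 0) //= big1 => [|i /negPf]; rewrite mxE ?eqxx ?mulr1 // => ->.
Qed.

Definition mx2 (a b c d : k) : 'M[k]_2 :=
  \matrix_(i, j) nth 0 (nth [::] [:: [:: a; b]; [:: c; d]] i) j.

Lemma det_mx2 (a b c d : k) : \det (mx2 a b c d) = a * d - b * c.
Proof. by rewrite det_mx22 !mxE. Qed.

Definition standard x (be ga : k) :=
  [/\ pf_al x.2 = 1, pf_be x.2 = be, pf_ga x.2 = ga, sg x 0 = 0 & sg x 1 = 1].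

(** By [frame_mul] and [frame_cong] the frames of x and y carry both points to the same point, so
    the inverse of one frame times the other maps x to y. *)
Lemma standard_orbit x y be ga : U x -> U y ->
  standard x be ga -> standard y be ga -> orbit_V x y.
Proof.
move=> /UE[ax p2x pdx] /UE[ay p2y pdy] [a1 b1 c1 s1 t1] [a2 b2 c2 s2 t2].
have ux : (frame x : 'M_4) \in unitmx.
  by rewrite unitmxE unitfE det_frame // oppr_eq0.
have uy : (frame y : 'M_4) \in unitmx.
  by rewrite unitmxE unitfE det_frame // oppr_eq0.
have E1 : (frame x : 'M_4) *m x.1 = (frame y : 'M_4) *m y.1.
  by rewrite [LHS]frame_mul [RHS]frame_mul s1 t1 s2 t2.
have E2 m : (frame x : 'M_4) *m x.2 m *m (frame x : 'M_4)^T =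
            (frame y : 'M_4) *m y.2 m *m (frame y : 'M_4)^T.
  by rewrite [LHS]frame_cong // [RHS]frame_cong // a1 b1 c1 s1 t1 a2 b2 c2 s2 t2.
exists (invmx (frame y : 'M_4) *m (frame x : 'M_4)), 1%:M, 1%:M.
rewrite unitmx_mul unitmx_inv ux uy unitmx1; split=> //.
rewrite [LHS]surjective_pairing; congr (_, _).
  by rewrite /act_W_L1 trmx1 mulmx1 -mulmxA E1 mulKmx.
apply/ffunP=> m; rewrite /= ffunE sum2E.
have I i : (1%:M : 'M[k]_2) m i = (m == i)%:R by rewrite mxE.
transitivity (invmx (frame y : 'M_4) *m ((frame x : 'M_4) *m x.2 m *m (frame x : 'M_4)^T)
   *m (invmx (frame y : 'M_4))^T).
  by rewrite E2 -!mulmxA mulKmx // -trmx_mul mulVmx // trmx1 mulmx1.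
rewrite trmx_mul !mulmxA; elim/ord2P: m {E2} I => I; rewrite !I /=;
  by rewrite scale1r scale0r ?addr0 ?add0r.
Qed.

(* The effect on X^2 + be X + ga of the substitution of c X + e for X, followed
   by division by c^2. *)
Lemma move_standard x be ga c e : c != 0 -> U x -> standard x be ga ->
  exists y, [/\ orbit_V x y, U y &
    standard y ((2%:R * e + be) / c) ((e ^+ 2 + be * e + ga) / c ^+ 2)].
Proof.
move=> c0 Ux [a1 b1 c1 s1 t1]; have [ax _ _] := (UE x).1 Ux.
(* The second GL_2 acts by the matrix with rows (c, 0) and (e, 1), which multiplies the leading
   coefficient by c^2; [\det g] compensates for this, and [\det h] then restores s_1 = 1. *)
have [g dg] := exists_det 3 (c ^- 2); have [h dh] := exists_det 1 (c ^+ 2).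
have ug : g \in unitmx by rewrite unitmxE unitfE dg invr_neq0 // expf_neq0.
have uh : h \in unitmx by rewrite unitmxE unitfE dh expf_neq0.
have uc : mx2 c 0 e 1 \in unitmx by rewrite unitmxE unitfE det_mx2 mul0r mulr1 subr0.
exists (act_W_L1 g h x.1, act_Lam2_L2 g (mx2 c 0 e 1) x.2); split.
- by exists g, h, (mx2 c 0 e 1).
- exact: U_act.
split; rewrite /= ?sg_act // ?pf_al_act // ?pf_be_act // ?pf_ga_act // /binary_form.
all: rewrite dg ?dh ?a1 ?b1 ?c1 ?s1 ?t1 !mxE /=; by field.
Qed.

Lemma exists_standard x : U x ->
  exists y be ga, [/\ orbit_V x y, U y & standard y be ga].
Proof.
move=> Ux; have [ax _ pd] := (UE x).1 Ux.
(* As [pf_dual x] is nonzero, so is the vector s, and some h sends it to (0, 1). *)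
have [h [uh h0 h1]] : exists h : 'M[k]_2, [/\ h \in unitmx,
    h 0 0 * sg x 0 + h 0 1 * sg x 1 = 0 & h 1 0 * sg x 0 + h 1 1 * sg x 1 = 1].
  have [s1|s1] := eqVneq (sg x 1) 0.
    have s0 : sg x 0 != 0.
      by apply: contraNneq pd => s0; rewrite /pf_dual s0 s1 !(expr0n, mulr0, mul0r) subr0 addr0.
    exists (mx2 0 1 (sg x 0)^-1 0); split; try by rewrite !mxE /= s1; field.
    by rewrite unitmxE unitfE det_mx2 mul0r mul1r sub0r oppr_eq0 invr_neq0.
  exists (mx2 1 (- sg x 0 / sg x 1) 0 (sg x 1)^-1); split;
    try by rewrite !mxE /=; field.
  by rewrite unitmxE unitfE det_mx2 mulr0 mul1r subr0 invr_neq0.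
pose y := (act_W_L1 1%:M 1%:M x.1, act_Lam2_L2 1%:M h x.2).
have u1 n : (1%:M : 'M[k]_n) \in unitmx by exact: unitmx1.
have Uy : U y by apply: U_act.
have xy : orbit_V x y by exists 1%:M, 1%:M, h.
have sy0 : sg y 0 = 0 by rewrite sg_act // !det1 !mul1r.
have sy1 : sg y 1 = 1 by rewrite sg_act // !det1 !mul1r.
have [ay _ pdy] := (UE y).1 Uy; clearbody y.
have al0 : pf_al y.2 != 0.
  by apply: contraNneq pdy => al0; rewrite /pf_dual al0 sy0 !(expr0n, mulr0, mul0r) subr0 addr0.
(* For s = (0, 1), [pf_dual] is the leading coefficient of F. Dividing F by it through [\det g]
   rescales s, which [\det h'] undoes. *)
have [g dg] := exists_det 3 (pf_al y.2)^-1; have [h' dh'] := exists_det 1 (pf_al y.2).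
have ug : g \in unitmx by rewrite unitmxE unitfE dg invr_neq0.
have uh' : h' \in unitmx by rewrite unitmxE unitfE dh'.
pose z := (act_W_L1 g h' y.1, act_Lam2_L2 g 1%:M y.2).
exists z, (pf_be z.2), (pf_ga z.2); split.
- by apply: orbit_V_trans xy _; exists g, h', 1%:M.
- exact: U_act.
split=> //; rewrite /= ?sg_act // ?pf_al_act // /binary_form.
all: rewrite ?dg ?dh' ?sy0 ?sy1 !mxE /=; by field.
Qed.

End Orbits.

(** * Lifting a semistable pair to U *)

Section ExistsU.
Variable k : fieldType.

Definition mx42 (u v : k * k * k * k) : 'M[k]_(4, 2) :=
  let: (u0, u1, u2, u3) := u in let: (v0, v1, v2, v3) := v in
  \matrix_(i, j) nth 0 (nth [::] [:: [:: u0; v0]; [:: u1; v1]; [:: u2; v2]; [:: u3; v3]] i) j.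

(** By contradiction: [pf_dual] is evaluated at pairs of vectors with entries 0, 1, -1. This yields
    orthogonality relations between the coordinates of b which force the discriminant to vanish, in
    every characteristic. *)
Lemma exists_U (b : pairT k) : Lam2L2_ss b -> exists a, U (a, b).
Proof.
move=> [ab p2b].
suff [a pda] : exists a, pf_dual (a, b) != 0 by exists a; apply/UE.
apply: contrapT => /forallNP/(_ (mx42 _ _)) nU.
have {}nU u v : pf_dual (mx42 u v, b) = 0 by apply/eqP; apply: contraPT (nU u v) => ?; apply.
move: p2b nU; rewrite P2E /pf_dual /sg /=; have := ab 0; have := ab 1.
rewrite /pf_al /pf_be /pf_ga.
move: (b 0) (b 1) => X Y.
(* x_ij, y_ij are, up to sign, the entries of the Hodge stars; hence the
   complementary indices. *)
case/alternatingP=> y23 y13 y12 y03 y02 y01; case/alternatingP=> x23 x13 x12 x03 x02 x01.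
rewrite !star_skew4 /pfpolar /Pfaffian !mxE /=.
set al := (X in 4%:R * X); set ga := (X in 4%:R * _ * X); set be := (X in X ^+ 2 - _) => D0.
(* [q] is [pf_dual] as a function of s = (x, y), and [w] pairs an alternating matrix, given by its
   six entries, with the bivector u /\ v. *)
pose q x y := al * y ^+ 2 - be * (x * y) + ga * x ^+ 2.
pose w (m01 m02 m03 m12 m13 m23 : k) (u v : k * k * k * k) :=
  let: (u0, u1, u2, u3) := u in let: (v0, v1, v2, v3) := v in
  m01 * (u0 * v1 - u1 * v0) + m02 * (u0 * v2 - u2 * v0) + m03 * (u0 * v3 - u3 * v0)
  + m12 * (u1 * v2 - u2 * v1) + m13 * (u1 * v3 - u3 * v1) + m23 * (u2 * v3 - u3 * v2).
move=> nU.
have H u v : q (w (- x01) x02 (- x03) (- x12) x13 (- x23) u v)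
               (w (- y01) y02 (- y03) (- y12) y13 (- y23) u v) = 0.
  rewrite -(nU u v) /q; case: u => [[[u0 u1] u2] u3]; case: v => [[[v0 v1] v2] v3].
  rewrite /w ![((mx42 _ _)^T *m _ *m _) _ _]mxE !sum4E.
  rewrite ![((mx42 _ _)^T *m _) _ _]mxE !sum4E !skew4E !mxE /=.
  by congr (al * _ ^+ 2 - be * (_ * _) + ga * _ ^+ 2); ring.
have {}H m v x y : w (- x01) x02 (- x03) (- x12) x13 (- x23) m v = x ->
    w (- y01) y02 (- y03) (- y12) y13 (- y23) m v = y -> q x y = 0 by move=> <- <-.
have q01 : q (- x01) (- y01) = 0 by apply: (H (1, 0, 0, 0) (0, 1, 0, 0)); rewrite /w; ring.
have q02 : q x02 y02 = 0 by apply: (H (1, 0, 0, 0) (0, 0, 1, 0)); rewrite /w; ring.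
have q03 : q (- x03) (- y03) = 0 by apply: (H (1, 0, 0, 0) (0, 0, 0, 1)); rewrite /w; ring.
have q12 : q (- x12) (- y12) = 0 by apply: (H (0, 1, 0, 0) (0, 0, 1, 0)); rewrite /w; ring.
have q13 : q x13 y13 = 0 by apply: (H (0, 1, 0, 0) (0, 0, 0, 1)); rewrite /w; ring.
have q23 : q (- x23) (- y23) = 0 by apply: (H (0, 0, 1, 0) (0, 0, 0, 1)); rewrite /w; ring.
(* The values of q on the bivectors e_i /\ (e_j +- e_l) show that the Pluecker
   coordinates of adjacent pairs are orthogonal for the polar form r of q. *)
pose r x y x' y' := 2%:R * al * (y * y') - be * (x * y' + x' * y) + 2%:R * ga * (x * x').
have rE x y x' y' : q x y = 0 -> q x' y' = 0 -> q (x + x') (y + y') = 0 -> r x y x' y' = 0.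
  move=> e1 e2 e3; have -> : r x y x' y' = q (x + x') (y + y') - q x y - q x' y'.
    by rewrite /r /q; ring.
  by rewrite e1 e2 e3 !subr0.
have r0103 : r (- x01) (- y01) (- x03) (- y03) = 0.
  by apply: rE => //; apply: (H (1, 0, 0, 0) (0, 1, 0, 1)); rewrite /w; ring.
have r0102 : r (- x01) (- y01) x02 y02 = 0.
  by apply: rE => //; apply: (H (1, 0, 0, 0) (0, 1, 1, 0)); rewrite /w; ring.
have r0112 : r (- x01) (- y01) (- x12) (- y12) = 0.
  by apply: rE => //; apply: (H (1, 0, -1, 0) (0, 1, 0, 0)); rewrite /w; ring.
have r0113 : r (- x01) (- y01) x13 y13 = 0.
  by apply: rE => //; apply: (H (1, 0, 0, -1) (0, 1, 0, 0)); rewrite /w; ring.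
have r0323 : r (- x03) (- y03) (- x23) (- y23) = 0.
  by apply: rE => //; apply: (H (1, 0, 1, 0) (0, 0, 0, 1)); rewrite /w; ring.
have r0313 : r (- x03) (- y03) x13 y13 = 0.
  by apply: rE => //; apply: (H (1, 1, 0, 0) (0, 0, 0, 1)); rewrite /w; ring.
have r0223 : r x02 y02 (- x23) (- y23) = 0.
  by apply: rE => //; apply: (H (1, 0, 0, -1) (0, 0, 1, 0)); rewrite /w; ring.
have r1223 : r (- x12) (- y12) (- x23) (- y23) = 0.
  by apply: rE => //; apply: (H (0, 1, 0, -1) (0, 0, 1, 0)); rewrite /w; ring.
have r1323 : r x13 y13 (- x23) (- y23) = 0.
  by apply: rE => //; apply: (H (0, 1, 1, 0) (0, 0, 0, 1)); rewrite /w; ring.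
pose rA := r x01 y01 x23 y23; pose rB := r x02 y02 x13 y13; pose rC := r x03 y03 x12 y12.
(* In (e_0 + e_2) /\ (e_1 + e_3) adjacent coordinates are orthogonal, so only the products of
   complementary ones, 01 with 23 and 03 with 12, survive. The relation [AB] comes likewise from
   (e_0 + e_3) /\ (e_1 + e_2). *)
have AC : rA = rC.
  have : q (- x01 - x03 + x12 - x23) (- y01 - y03 + y12 - y23) = 0.
    by apply: (H (1, 0, 1, 0) (0, 1, 0, 1)); rewrite /w; ring.
  have -> : q (- x01 - x03 + x12 - x23) (- y01 - y03 + y12 - y23) =
     q (- x01) (- y01) + q (- x03) (- y03) + q (- x12) (- y12) + q (- x23) (- y23)
     + r (- x01) (- y01) (- x03) (- y03) - r (- x01) (- y01) (- x12) (- y12)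
     + r (- x03) (- y03) (- x23) (- y23) - r (- x12) (- y12) (- x23) (- y23)
     + (rA - rC) by rewrite /rA /rC /q /r; ring.
  rewrite q01 q03 q12 q23 r0103 r0112 r0323 r1223 !addr0 !subr0 add0r.
  by move/eqP; rewrite subr_eq0 => /eqP.
have AB : rB = - rA.
  have : q (- x01 + x02 - x13 + x23) (- y01 + y02 - y13 + y23) = 0.
    by apply: (H (1, 0, 0, 1) (0, 1, 1, 0)); rewrite /w; ring.
  have -> : q (- x01 + x02 - x13 + x23) (- y01 + y02 - y13 + y23) =
     q (- x01) (- y01) + q x02 y02 + q x13 y13 + q (- x23) (- y23)
     + r (- x01) (- y01) x02 y02 - r (- x01) (- y01) x13 y13
     - r x02 y02 (- x23) (- y23) + r x13 y13 (- x23) (- y23)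
     - (rA + rB) by rewrite /rA /rB /q /r; ring.
  rewrite q01 q02 q13 q23 r0102 r0113 r0223 r1323 !addr0 !subr0 add0r.
  by move=> /eqP; rewrite oppr_eq0 => /eqP AB; apply: (addrI rA); rewrite AB subrr.
(* The discriminant is - (rA - rB + rC), hence -3 rA. *)
have A0 : rA != 0.
  apply: contraNneq D0 => A0.
  have -> : be ^+ 2 - 4%:R * al * ga = - (rA - rB + rC).
    by rewrite /rA /rB /rC /r /be /al /ga; ring.
  by rewrite -AC AB A0 !(oppr0, addr0).
(* (x02, y02) and (x03, y03) are both orthogonal to (x23, y23), hence
   proportional, while only the second is orthogonal to (x13, y13). *)
have det0 : x02 * y03 - x03 * y02 = 0.
  apply: (mulfI A0); rewrite mulr0.
  have -> : rA * (x02 * y03 - x03 * y02) =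
      r (- x03) (- y03) (- x23) (- y23) * (x02 * y01 - y02 * x01)
      - r x02 y02 (- x23) (- y23) * (x01 * y03 - y01 * x03) by rewrite /rA /r; ring.
  by rewrite r0323 r0223 !mul0r subr0.
have B0 : rB != 0 by rewrite AB oppr_eq0.
have x03_0 : x03 = 0.
  apply: (mulfI B0); rewrite mulr0.
  have -> : rB * x03 = - (r (- x03) (- y03) x13 y13) * x02
     - (2%:R * al * y13 - be * x13) * (x02 * y03 - x03 * y02) by rewrite /rB /r; ring.
  by rewrite r0313 det0 oppr0 mul0r mulr0 subr0.
have y03_0 : y03 = 0.
  apply: (mulfI B0); rewrite mulr0.
  have -> : rB * y03 = - (r (- x03) (- y03) x13 y13) * y02
     + (2%:R * ga * x13 - be * y13) * (x02 * y03 - x03 * y02) by rewrite /rB /r; ring.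
  by rewrite r0313 det0 oppr0 !mul0r mulr0 addr0.
move: A0; rewrite AC /rC /r x03_0 y03_0 !(mul0r, mulr0, addr0, subr0).
by rewrite eqxx.
Qed.

End ExistsU.

(** * Isotropic binary forms and quadratic extensions *)

(** Roots are taken on the projective line: for a = 0 the point (1 : 0) is one. *)
Definition isotropic (R : fieldType) (a b c : R) :=
  exists x y, ((x != 0) || (y != 0)) /\ binary_form a b c x y = 0.

Section Isotropic.
Variables (R : fieldType).
Implicit Types a b c d x y r z : R.

Lemma isotropic0 b c : isotropic 0 b c.
Proof.
exists 1, 0; split; first by rewrite oner_eq0.
by rewrite /binary_form !(mul0r, mulr0, expr0n, addr0).
Qed.

Lemma isotropicP a b c : a != 0 ->
  isotropic a b c <-> exists r, binary_form a b c r 1 = 0.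
Proof.
move=> a0; split=> [[x [y [xy E]]]|[r E]]; last first.
  by exists r, 1; rewrite oner_eq0 orbT.
have y0 : y != 0.
  apply: contraTneq xy => y0; move: E; rewrite y0 /binary_form !(mulr0, expr0n, addr0) /=.
  by move/eqP; rewrite mulf_eq0 (negPf a0) sqrf_eq0 /= eqxx orbF negbK.
exists (x / y); rewrite -[LHS](mulfK (expf_neq0 2 y0)) -[RHS](mul0r (y ^- 2)) -E.
by congr (_ / _); rewrite /binary_form; field.
Qed.

(** By Vieta the other root is - b / a - r, so it lies in every field containing r and the
    coefficients. *)
Lemma binary_form_factor a b c r z : a != 0 -> binary_form a b c r 1 = 0 ->
  binary_form a b c z 1 = a * (z - r) * (z - (- b / a - r)).
Proof. by move=> a0 E; rewrite -[LHS]subr0 -E /binary_form; field. Qed.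

(** The coefficients assumed isotropic are those of d times the form after the substitution (x, y)
    -> (x p + y s, x q + y t). Cramer's rule shows that this sends nonzero vectors to nonzero
    vectors. *)
Lemma isotropic_subst a b c d p q s t : d != 0 -> p * t - q * s != 0 ->
  isotropic (d * binary_form a b c p q)
    (d * (2%:R * a * (p * s) + b * (p * t + q * s) + 2%:R * c * (q * t)))
    (d * binary_form a b c s t) -> isotropic a b c.
Proof.
move=> d0 D0 [x [y [xy E]]]; exists (x * p + y * s), (x * q + y * t); split.
  rewrite -negb_and; apply: contraL xy => /andP[/eqP e1 /eqP e2].
  rewrite -negb_and negbK; apply/andP; split; apply/eqP; apply: (mulfI D0); rewrite mulr0.
    have -> : (p * t - q * s) * x = (x * p + y * s) * t - (x * q + y * t) * s by ring.
    by rewrite e1 e2 !mul0r subr0.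
  have -> : (p * t - q * s) * y = (x * q + y * t) * p - (x * p + y * s) * q by ring.
  by rewrite e1 e2 !mul0r subr0.
apply: (mulfI d0); rewrite mulr0 -E /binary_form; ring.
Qed.

End Isotropic.

Section RootField.
Variables (k : fieldType).
Implicit Types (al be ga : k) (L : fieldExtType k).

(* Unlike the splitting field of the dehomogenized polynomial, this condition
   is visibly invariant under the linear changes of variables of the form, which
   may move a root to infinity. *)
Definition root_field al be ga L :=
  [/\ (\dim {:L} <= 2)%N, isotropic (al%:A : L) be%:A ga%:A &
      isotropic al be ga -> \dim {:L} = 1%N].

Lemma mem1P L (z : L) : reflect (exists c, z = c%:A) (z \in 1%VS).
Proof. exact: vlineP. Qed.

Lemma alg_eq0 L (c : k) : (c%:A == 0 :> L) = (c == 0).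
Proof. by rewrite scaler_eq0 oner_eq0 orbF. Qed.

Lemma binary_form_alg L al be ga x y :
  (binary_form al be ga x y)%:A = binary_form (al%:A : L) be%:A ga%:A x%:A y%:A.
Proof. by rewrite /binary_form -!in_algE !(rmorphD, rmorphM, rmorphXn). Qed.

Lemma isotropic_alg L al be ga :
  isotropic al be ga -> isotropic (al%:A : L) be%:A ga%:A.
Proof.
move=> [x [y [xy E]]]; exists x%:A, y%:A.
by rewrite !alg_eq0 -binary_form_alg E scale0r.
Qed.

Lemma dim1_scalar L : \dim {:L} = 1%N -> forall z : L, exists c, z = c%:A.
Proof.
move=> d1 z; apply/mem1P.
suff -> : 1%VS = fullv :> {vspace L} by rewrite memvf.
by apply/eqP; rewrite eqEdim subvf dimv1 d1.
Qed.

Lemma scalar_dim1 L : (forall z : L, z \in 1%VS) -> \dim {:L} = 1%N.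
Proof.
move=> s; rewrite -[RHS](dimv1 L); congr (\dim _).
by apply/eqP; rewrite eqEsubv sub1v andbT; apply/subvP.
Qed.

Lemma dim2_basis L (r : L) : r \notin 1%VS -> (\dim {:L} <= 2)%N ->
  (forall z : L, exists u v : k, z = u%:A + v%:A * r) /\
  (forall u v : k, u%:A + v%:A * r = 0 -> u = 0 /\ v = 0).
Proof.
move=> r1 d2; have free_r : free [:: r; 1].
  by rewrite free_cons span_seq1 r1 seq1_free oner_eq0.
split=> [z|u v E].
  have : basis_of fullv [:: r; 1] by rewrite basisEfree free_r subvf.
  move/span_basis => def; have : z \in <<[:: r; 1%R]>>%VS by rewrite def memvf.
  rewrite span_cons span_seq1 => /memv_addP[_ /vlineP[v ->] [_ /vlineP[u ->] ->]].
  by exists u, v; rewrite mulr_algl addrC.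
have v0 : v = 0.
  apply/eqP; apply: contraNT r1 => v0; apply/mem1P; exists (- u / v).
  have v0' : v%:A != 0 :> L by rewrite alg_eq0.
  have Er : v%:A * r = - u%:A by apply/eqP; rewrite -addr_eq0 addrC E.
  by apply: (mulfI v0'); rewrite Er -!in_algE -rmorphM mulrC divfK // rmorphN.
split=> //; apply/eqP; rewrite -(alg_eq0 L).
by move: E; rewrite v0 scale0r mul0r addr0 => ->.
Qed.

Lemma dehomogenizeE (q : 'rV[k]_2 -> k) al be ga :
  (forall v, q v = binary_form al be ga (v 0 0) (v 0 1)) ->
  dehomogenize q = al *: 'X^2 + be *: 'X + ga%:P.
Proof. by move=> /binary_formE[qa qb qc]; rewrite /dehomogenize qa qb qc. Qed.

Definition quad_poly (R : nzRingType) (a b c : R) : {poly R} := a *: 'X^2 + b *: 'X + c%:P.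

Lemma horner_quad_poly (R : fieldType) (a b c z : R) :
  (quad_poly a b c).[z] = binary_form a b c z 1.
Proof. by rewrite /binary_form /quad_poly expr1n !mulr1 !hornerE. Qed.

Lemma map_quad_poly L al be ga :
  map_poly (in_alg L) (quad_poly al be ga) = quad_poly (al%:A : L) be%:A ga%:A.
Proof.
by rewrite /quad_poly !rmorphD /= !linearZ /= map_polyXn map_polyX map_polyC.
Qed.

Lemma size_quad_poly (R : fieldType) (a b c : R) : a != 0 -> size (quad_poly a b c) = 3%N.
Proof.
move=> a0; rewrite /quad_poly -addrA size_polyDl size_scale // size_polyXn //.
rewrite (leq_ltn_trans (size_polyD _ _)) // gtn_max.
rewrite (leq_ltn_trans (size_scale_leq _ _)) ?size_polyX //.
by rewrite (leq_ltn_trans (size_polyC_leq1 _)).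
Qed.

Lemma quad_poly_factor (R : fieldType) (a b c r : R) : a != 0 -> binary_form a b c r 1 = 0 ->
  quad_poly a b c = a *: (('X - r%:P) * ('X - (- b / a - r)%:P)).
Proof.
move=> a0 E; have -> : c = a * r * (- b / a - r).
  rewrite -[LHS]subr0 -E /binary_form; field; exact: a0.
rewrite /quad_poly -!mul_polyC !(rmorphM, rmorphB) /=.
have -> : b%:P = - a%:P * (- b / a)%:P by rewrite -polyCN -polyCM; congr _%:P; field.
by ring.
Qed.

(** If al = 0, the discriminant makes be nonzero, the polynomial is linear and its root is rational.
    Otherwise one root r generates the same field as both, and its minimal polynomial has degree at
    most 2. *)
Lemma generated_by_rootsE (q : 'rV[k]_2 -> k) al be ga L :
  (forall v, q v = binary_form al be ga (v 0 0) (v 0 1)) ->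
  be ^+ 2 - 4%:R * al * ga != 0 ->
  generated_by_roots q L <-> root_field al be ga L.
Proof.
move=> qE D0; rewrite /generated_by_roots (dehomogenizeE qE).
rewrite -/(quad_poly al be ga) map_quad_poly.
set a := al%:A; set b := be%:A; set c := ga%:A.
have [al0|al0] := eqVneq al 0.
  have be0 : be != 0.
    by apply: contraNneq D0 => ->; rewrite al0 expr0n !(mulr0, mul0r) subr0.
  have b0 : b != 0 by rewrite alg_eq0.
  have fac : quad_poly a b c = b *: ('X - (- c / b)%:P).
    rewrite /quad_poly /a al0 !scale0r add0r scalerBr -!mul_polyC -polyCM mulNr mulrN.
    by rewrite [b * _]mulrC divfK // rmorphN opprK.
  split=> [[rs prs defL]|[_ _ /(_ _)d1]].
    have d1 : \dim {:L} = 1%N.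
      apply: scalar_dim1 => z; have: z \in fullv by exact: memvf.
      rewrite -defL; apply: subvP; apply/(@Fadjoin_seqP _ _ 1%AS _ 1%AS); split=> // r rrs.
      have: root (quad_poly a b c) r by rewrite (eqp_root prs) root_prod_XsubC.
      rewrite fac rootZ // root_XsubC => /eqP->.
      by apply/mem1P; exists (- ga / be); rewrite -!in_algE fmorph_div rmorphN.
    by split; rewrite ?d1 // /a al0 scale0r; apply: isotropic0.
  have {}d1 : \dim {:L} = 1%N by apply: d1; rewrite al0; apply: isotropic0.
  exists [:: - c / b]; first by rewrite fac big_seq1 eqp_scale.
  apply/eqP; rewrite eqEsubv subvf; apply/subvP => z _.
  have [u ->] := dim1_scalar d1 z; apply: subvP (subv_adjoin_seq _ _) _ _.
  by apply/mem1P; exists u.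
have a0 : a != 0 by rewrite alg_eq0.
split=> [[rs prs defL]|[d2 /(isotropicP _ _ a0)[r Er] d1]].
  have rootE z : (z \in rs) = (binary_form a b c z 1 == 0).
    by rewrite -root_prod_XsubC -(eqp_root prs) rootE horner_quad_poly.
  have [r rrs] : exists r, r \in rs.
    case: rs {defL rootE} prs => [|r rs _]; last by exists r; rewrite mem_head.
    by rewrite big_nil => /eqp_size; rewrite size_quad_poly // size_poly1.
  have Er : binary_form a b c r 1 = 0 by apply/eqP; rewrite -rootE.
  have defLr (E : {subfield L}) : r \in E -> (fullv <= E)%VS.
    move=> rE; rewrite -defL; apply/Fadjoin_seqP; split=> [|z]; first exact: sub1v.
    rewrite rootE (binary_form_factor _ a0 Er) !mulf_eq0 (negPf a0) !subr_eq0 /=.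
    have E1 (u : k) : u%:A \in E by rewrite rpredZ // rpred1.
    by case/orP=> /eqP-> //; rewrite rpredB // rpred_div ?rpredN ?E1.
  split; last first.
  - rewrite isotropicP // => -[u Eu]; apply: scalar_dim1 => z.
    have ru : r \in 1%VS.
      have /esym/eqP := binary_form_alg L al be ga u 1.
      rewrite Eu scale0r scale1r (binary_form_factor _ a0 Er) !mulf_eq0 (negPf a0) !subr_eq0 /=.
      case/orP=> [/eqP<-|]; first by apply/mem1P; exists u.
      rewrite eq_sym subr_eq addrC -subr_eq => /eqP <-.
      by apply/mem1P; exists (- be / al - u); rewrite -!in_algE rmorphB fmorph_div rmorphN.
    by apply: subvP (defLr 1%AS ru) _ _; rewrite memvf.
  - by apply/isotropicP => //; exists r.
  apply: leq_trans (dimvS (defLr <<1; r>>%AS (memv_adjoin _ _))) _.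
  rewrite dim_Fadjoin dimv1 muln1 -ltnS -size_minPoly -(size_quad_poly b c a0).
  apply: dvdp_leq; first by rewrite -size_poly_eq0 size_quad_poly.
  apply: minPoly_dvdp; first by rewrite -map_quad_poly alg_polyOver.
  by rewrite /root horner_quad_poly Er.
exists [:: r; - b / a - r].
  by rewrite (quad_poly_factor a0 Er) big_cons big_seq1 eqp_scale.
apply/eqP; rewrite eqEsubv subvf; apply/subvP => z _.
have [ri|r1] := boolP (r \in 1%VS).
  have {}d1 : \dim {:L} = 1%N.
    apply: d1; apply/isotropicP => //; have /mem1P[u ru] := ri; exists u.
    by apply/eqP; rewrite -(alg_eq0 L) binary_form_alg scale1r -ru; apply/eqP.
  have [u ->] := dim1_scalar d1 z; apply: subvP (subv_adjoin_seq _ _) _ _.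
  by apply/mem1P; exists u.
have [/(_ z)[u [v ->]] _] := dim2_basis r1 d2.
rewrite rpredD //; first by apply: subvP (subv_adjoin_seq _ _) _ _; apply/mem1P; exists u.
rewrite mulr_algl rpredZ // seqv_sub_adjoin //; exact: mem_head.
Qed.

(* Requiring equal relations instead of the freeness of 1, r allows dimension 1,
   with r = 0 and r' = 0. *)
Lemma ext_isom_quadratic L L' (r : L) (r' : L') (s t : k) :
  r ^+ 2 = s%:A + t%:A * r -> r' ^+ 2 = s%:A + t%:A * r' ->
  (forall z : L, exists u v : k, z = u%:A + v%:A * r) ->
  (forall z : L', exists u v : k, z = u%:A + v%:A * r') ->
  (forall u v : k, u%:A + v%:A * r = 0 <-> u%:A + v%:A * r' = 0) ->
  ext_isom L L'.
Proof.
move=> r2 r2' gen gen' ker.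
(* Coordinates are picked by choice, and [kerK] makes the image independent of them. The fields are
   arbitrary so that the inverse arises in the same way. *)
have tr (K K' : fieldExtType k) (x : K) (x' : K') :
    (forall z : K, exists u v : k, z = u%:A + v%:A * x) ->
    (forall u v : k, u%:A + v%:A * x = 0 -> u%:A + v%:A * x' = 0) ->
    {f : K -> K' | forall u v : k, f (u%:A + v%:A * x) = u%:A + v%:A * x'}.
  move=> genK kerK; have h z : {w : k * k | z = w.1%:A + w.2%:A * x}.
    by apply: cid; have [u [v ->]] := genK z; exists (u, v).
  exists (fun z => (sval (h z)).1%:A + (sval (h z)).2%:A * x') => u v.
  case: (h _) => -[u' v'] /= E; apply/eqP; rewrite -subr_eq0; apply/eqP.
  have sub (M : fieldExtType k) (y : M) :
      u'%:A + v'%:A * y - (u%:A + v%:A * y) = (u' - u)%:A + (v' - v)%:A * y.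
    by rewrite -!in_algE !rmorphB /=; ring.
  by rewrite sub; apply: kerK; rewrite -sub E subrr.
have [f fE] := tr _ _ _ _ gen (fun u v => (ker u v).1).
have [g gE] := tr _ _ _ _ gen' (fun u v => (ker u v).2).
have lin : linear f.
  move=> c z w; have [u [v ->]] := gen z; have [u' [v' ->]] := gen w.
  have sum (M : fieldExtType k) (y : M) :
      c *: (u%:A + v%:A * y) + (u'%:A + v'%:A * y) = (c * u + u')%:A + (c * v + v')%:A * y.
    by rewrite -(mulr_algl c) -!in_algE !(rmorphD, rmorphM) /=; ring.
  by rewrite sum !fE -sum.
have mul : monoid_morphism f.
  split=> [|z w].
    have one (M : fieldExtType k) (y : M) : 1 = 1%:A + 0%:A * y.
      by rewrite scale1r scale0r mul0r addr0.
    by rewrite (one _ r) fE -one.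
  have [u [v ->]] := gen z; have [u' [v' ->]] := gen w.
  have prod (M : fieldExtType k) (y : M) : y ^+ 2 = s%:A + t%:A * y ->
      (u%:A + v%:A * y) * (u'%:A + v'%:A * y) =
      (u * u' + v * v' * s)%:A + (u * v' + v * u' + v * v' * t)%:A * y.
    move=> y2; transitivity (u%:A * u'%:A + (u%:A * v'%:A + v%:A * u'%:A) * y
      + v%:A * v'%:A * y ^+ 2).
      by ring.
    by rewrite y2 -!in_algE !(rmorphD, rmorphM) /=; ring.
  by rewrite prod // !fE -prod.
pose fl := GRing.isLinear.Build k L L' *:%R f lin.
pose fm := GRing.isMonoidMorphism.Build L L' f mul.
pose F : {lrmorphism L -> L'} := HB.pack f fl fm.
exists F; exists g => z; first by have [u [v ->]] := gen z; rewrite /= fE gE.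
by have [u [v ->]] := gen' z; rewrite /= gE fE.
Qed.

Lemma bij_dim L L' (f : {linear L -> L'}) : bijective f -> \dim {:L} = \dim {:L'}.
Proof.
move=> [g fK gK]; have fi : injective (linfun f).
  by move=> x y; rewrite !lfunE => /(can_inj fK).
rewrite -(limg_dim_eq (f := linfun f) (U := fullv)); last first.
  by move/lker0P/eqP: fi => ->; rewrite capv0.
congr (\dim _); apply/eqP; rewrite eqEsubv subvf; apply/subvP => z _.
by rewrite -(gK z) -[f _](lfunE f) memv_img ?memvf.
Qed.

Lemma root_field_isom al be ga L L' :
  ext_isom L L' -> root_field al be ga L -> root_field al be ga L'.
Proof.
move=> [f f_bij] [d2 [x [y [xy E]]] d1]; have dE := bij_dim f_bij.
split; rewrite -?dE //; exists (f x), (f y); rewrite !fmorph_eq0; split=> //.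
have fA c : f c%:A = c%:A by rewrite linearZ /= rmorph1.
by rewrite -[RHS](rmorph0 f) -E /binary_form -!fA !(rmorphD, rmorphM, rmorphXn).
Qed.

Lemma root_field_irrational al be ga L : root_field al be ga L -> \dim {:L} != 1%N ->
  exists r : L, [/\ al != 0, binary_form al%:A be%:A ga%:A r 1 = 0 & r \notin 1%VS].
Proof.
move=> [d2 isoL d1] dn1; have nis : ~ isotropic al be ga by move=> /d1 e; rewrite e in dn1.
have al0 : al != 0.
  by apply/eqP => al0; apply: nis; rewrite al0; apply: isotropic0.
have a0 : al%:A != 0 :> L by rewrite alg_eq0.
have [r Er] := (isotropicP _ _ a0).1 isoL; exists r; split=> //.
apply/mem1P => -[c rc]; apply: nis; apply/isotropicP => //; exists c.
by apply/eqP; rewrite -(alg_eq0 L) binary_form_alg scale1r -rc; apply/eqP.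
Qed.

Lemma root_field_quadratic al be ga L (r : L) : al != 0 ->
  binary_form al%:A be%:A ga%:A r 1 = 0 ->
  r ^+ 2 = (- ga / al)%:A + (- be / al)%:A * r.
Proof.
move=> al0; rewrite -!in_algE !(fmorph_div, rmorphN) /= => E.
have a0 : al%:A != 0 :> L by rewrite alg_eq0.
by apply: (mulfI a0); rewrite -[LHS]subr0 -E /binary_form; field.
Qed.

(** If L = k, the isotropic vector over L is rational, and the last clause of [root_field] applies
    to L'. *)
Lemma root_field_dim1E al be ga L L' :
  root_field al be ga L -> root_field al be ga L' ->
  \dim {:L} = 1%N -> \dim {:L'} = 1%N.
Proof.
move=> [_ [x [y [xy E]]] _] [_ _ d1'] dL; apply: d1'.
have [[u ux] [v vy]] := (dim1_scalar dL x, dim1_scalar dL y).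
exists u, v; rewrite -!(alg_eq0 L) -ux -vy; split=> //.
by apply/eqP; rewrite -(alg_eq0 L) binary_form_alg -ux -vy; apply/eqP.
Qed.

(** Either both fields are k, or each has a basis 1, r with r a root of the same polynomial. *)
Lemma root_field_unique al be ga L L' :
  root_field al be ga L -> root_field al be ga L' -> ext_isom L L'.
Proof.
move=> rL rL'; have [dL|dL] := eqVneq (\dim {:L}) 1%N.
  have dL' := root_field_dim1E rL rL' dL.
  have gen (M : fieldExtType k) : \dim {:M} = 1%N ->
      forall z : M, exists u v : k, z = u%:A + v%:A * 0.
    by move=> dM z; have [u ->] := dim1_scalar dM z; exists u, 0; rewrite mulr0 addr0.
  apply: (@ext_isom_quadratic _ _ 0 0 0 0); rewrite ?scale0r ?mul0r ?expr0n ?addr0 //.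
  - exact: gen.
  - exact: gen.
  by move=> u v; rewrite !mulr0 !addr0; split=> /eqP;
    rewrite alg_eq0 => /eqP->; rewrite scale0r.
have dL' : \dim {:L'} != 1%N.
  by apply: contra_neq dL => dL'; apply: root_field_dim1E rL' rL dL'.
have [r [al0 Er r1]] := root_field_irrational rL dL.
have [r' [_ Er' r1']] := root_field_irrational rL' dL'.
have [[d2 _ _] [d2' _ _]] := (rL, rL').
have [gen free] := dim2_basis r1 d2; have [gen' free'] := dim2_basis r1' d2'.
apply: (ext_isom_quadratic (root_field_quadratic al0 Er) (root_field_quadratic al0 Er')) => //.
by move=> u v; split=> [/free|/free'] [-> ->]; rewrite !scale0r mul0r addr0.
Qed.

Lemma root_field_separable al be ga L : be ^+ 2 - 4%:R * al * ga != 0 ->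
  root_field al be ga L -> separable_le2 L.
Proof.
move=> D0 rL; have [d2 _ _] := rL; split=> //.
have [dL|dL] := eqVneq (\dim {:L}) 1%N.
  have -> : fullv = 1%VS :> {vspace L}.
    by apply/esym/eqP; rewrite eqEdim subvf dimv1 dL.
  exact: separable_refl.
have [r [al0 Er r1]] := root_field_irrational rL dL.
have <- : <<1; r>>%VS = fullv.
  apply/eqP; rewrite eqEsubv subvf; apply/subvP => z _.
  have [/(_ z)[u [v ->]] _] := dim2_basis r1 d2.
  rewrite rpredD //; first by apply: subvP (subv_adjoin _ _) _ _; apply/mem1P; exists u.
  by rewrite mulr_algl rpredZ // memv_adjoin.
rewrite -(adjoin_separable_eq 1%AS); apply/separable_elementP.
exists (map_poly (in_alg L) (quad_poly al be ga)); split.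
- exact: alg_polyOver.
- by rewrite map_quad_poly /root horner_quad_poly Er.
rewrite separable_map separable_poly.unlock; apply/Bezout_coprimepP.
(* Bezout relation for P = al X^2 + be X + ga: P'^2 - 4 al P is the discriminant. *)
exists (- (4%:R * al)%:P, (quad_poly al be ga)^`()) => /=.
have -> : - (4%:R * al)%:P * quad_poly al be ga
    + (quad_poly al be ga)^`() * (quad_poly al be ga)^`() =
    (be ^+ 2 - 4%:R * al * ga)%:P.
  rewrite /quad_poly !derivD !derivZ derivC derivXn derivX -!mul_polyC.
  by rewrite !(rmorphB, rmorphM, rmorphXn, rmorph_nat) /=; ring.
by rewrite polyC_eqp1.
Qed.

Lemma root_field_exists al be ga : exists L, root_field al be ga L.
Proof.
have [iso|niso] := pselect (isotropic al be ga).
  (* Adjoining a root of the linear polynomial X realizes k as an extension of itself. *)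
  have [L dL _] := irredp_FAdjoin (irredp_XsubC (0 : k)); rewrite size_XsubC in dL.
  by exists L; split; rewrite ?dL //; apply: isotropic_alg.
have al0 : al != 0.
  by apply/eqP => al0; apply: niso; rewrite al0; apply: isotropic0.
have irr : irreducible_poly (quad_poly al be ga).
  apply: cubic_irreducible => [|x]; first by rewrite size_quad_poly.
  apply/negP => /rootP; rewrite horner_quad_poly => E; apply: niso.
  by apply/isotropicP => //; exists x.
have [L dL [z rz _]] := irredp_FAdjoin irr; rewrite size_quad_poly // in dL.
exists L; split; rewrite ?dL //; apply/isotropicP; first by rewrite alg_eq0.
by exists z; move/rootP: rz; rewrite map_quad_poly horner_quad_poly.
Qed.

(** For z outside k write z^2 = u + v z. Then P = X^2 - v X - u is the minimal polynomial of z,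
    separability gives P'(z) != 0, and P'(z)^2 is the discriminant. *)
Lemma separable_root_field L : separable_le2 L ->
  exists be ga : k, be ^+ 2 - 4%:R * ga != 0 /\ root_field 1 be ga L.
Proof.
move=> [sepL d2]; have [dL|dL] := eqVneq (\dim {:L}) 1%N.
  (* X^2 + X splits over k and has discriminant 1 in every characteristic. *)
  exists 1, 0; rewrite expr1n mulr0 subr0 oner_eq0; split=> //; split; rewrite ?dL //.
  apply: isotropic_alg; exists 0, 1; rewrite oner_eq0 orbT; split=> //.
  by rewrite /binary_form; ring.
have [z z1] : exists z : L, z \notin 1%VS.
  apply: contrapT => /forallNP nz; case/eqP: dL; apply: scalar_dim1 => z.
  by have /negP := nz z; rewrite negbK.
have [/(_ (z ^+ 2))[u [v Ez]] _] := dim2_basis z1 d2.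
have Q0 : binary_form 1 (- v)%:A (- u)%:A z 1 = 0 :> L.
  by rewrite /binary_form Ez -!in_algE !rmorphN; ring.
have a0 : 1 != 0 :> L by rewrite oner_eq0.
exists (- v), (- u); split; last first.
  split=> //; first by rewrite scale1r; apply/isotropicP => //; exists z.
  move/(isotropicP _ _ (oner_neq0 k)) => [t Et]; case/mem1P: z1.
  have /esym/eqP := binary_form_alg L 1 (- v) (- u) t 1.
  rewrite Et scale0r scale1r (binary_form_factor _ a0 Q0) !mulf_eq0 (negPf a0) !subr_eq0 /=.
  case/orP=> [/eqP<-|]; first by exists t.
  rewrite eq_sym subr_eq addrC -subr_eq => /eqP <-; exists (v - t).
  by rewrite -!in_algE rmorphB rmorphN divr1 opprK.
set P := quad_poly (1 : L) (- v)%:A (- u)%:A.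
have PK : P \is a polyOver 1%VS.
  have -> : P = map_poly (in_alg L) (quad_poly 1 (- v) (- u)).
    by rewrite map_quad_poly scale1r.
  exact: alg_polyOver.
have mP : minPoly 1%VS z %= P.
  rewrite -dvdp_size_eqp; last by apply: minPoly_dvdp; rewrite // /root horner_quad_poly Q0.
  rewrite eqn_leq dvdp_leq ?minPoly_dvdp //; last 2 first.
  - by rewrite -size_poly_eq0 size_quad_poly.
  - by rewrite /root horner_quad_poly Q0.
  rewrite size_quad_poly // size_minPoly ltnS ltn_neqAle eq_sym.
  by rewrite (adjoin_deg_eq1 1%AS) z1.
have /separableP/(_ z (memvf z)) := sepL.
have mE : minPoly 1%VS z = P.
  apply/eqP; rewrite -eqp_monic ?(monic_minPoly 1%AS) //.
  by rewrite monicE lead_coefE size_quad_poly //= /P /quad_poly !coefE /=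
    !(mulr1, mulr0, addr0).
rewrite /separable_element separable_poly.unlock mE => /coprimep_root.
move/(_ z); rewrite /root horner_quad_poly Q0 eqxx => /(_ isT).
apply: contraNneq => D0.
rewrite -sqrf_eq0.
have -> : P^`().[z] = z *+ 2 - v%:A.
  rewrite /P /quad_poly !derivD !derivZ derivC derivXn derivX !hornerE.
  by rewrite scaleNr; ring.
have -> : (z *+ 2 - v%:A) ^+ 2 =
    ((- v) ^+ 2 - 4%:R * - u)%:A + 4%:R * (z ^+ 2 - (u%:A + v%:A * z)).
  by rewrite -!in_algE !(rmorphB, rmorphN, rmorphM, rmorphXn, rmorph_nat) /=; ring.
by rewrite D0 Ez subrr mulr0 scale0r addr0.
Qed.

(** The map X -> c X + e is to send the roots of the second polynomial to those of the first. *)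
Lemma root_field_affine be ga be' ga' L :
  be ^+ 2 - 4%:R * ga != 0 -> be' ^+ 2 - 4%:R * ga' != 0 ->
  root_field 1 be ga L -> root_field 1 be' ga' L ->
  exists c e : k, [/\ c != 0, 2%:R * e + be = c * be' & e ^+ 2 + be * e + ga = c ^+ 2 * ga'].
Proof.
move=> D0 D0' rL rL'; have o0 := oner_neq0 k; have [dL|dL] := eqVneq (\dim {:L}) 1%N.
  have rat b g : root_field 1 b g L -> exists t : k, t ^+ 2 + b * t + g = 0.
    move=> [_ [x [y [xy E]]] _].
    have [[u ux] [v vy]] := (dim1_scalar dL x, dim1_scalar dL y).
    have [|t Et] := (isotropicP b g o0).1.
      exists u, v; rewrite -!(alg_eq0 L) -ux -vy; split=> //.
      by apply/eqP; rewrite -(alg_eq0 L) binary_form_alg -ux -vy; apply/eqP.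
    by exists t; rewrite -Et /binary_form; ring.
  have [t Et] := rat _ _ rL; have [t' Et'] := rat _ _ rL'.
  have nz (b g s : k) : s ^+ 2 + b * s + g = 0 -> b ^+ 2 - 4%:R * g != 0 -> 2%:R * s + b != 0.
    move=> Es; apply: contraNneq => e0.
    have -> : b ^+ 2 - 4%:R * g = (2%:R * s + b) ^+ 2 - 4%:R * (s ^+ 2 + b * s + g) by ring.
    by rewrite e0 Es expr0n mulr0 subr0.
  have n1 := nz _ _ _ Et D0; have n2 := nz _ _ _ Et' D0'.
  have gaE : ga = - t ^+ 2 - be * t by rewrite -[LHS]subr0 -Et; ring.
  have gaE' : ga' = - t' ^+ 2 - be' * t' by rewrite -[LHS]subr0 -Et'; ring.
  (* 2 t + be is the difference of the two roots t and - be - t. So c is the ratio of the root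
     differences, and e is chosen to send t' to t. *)
  exists ((2%:R * t + be) / (2%:R * t' + be')), (t - (2%:R * t + be) / (2%:R * t' + be') * t').
  split; first by rewrite mulf_neq0 // invr_neq0.
    by field.
  by rewrite gaE gaE'; field.
have [r [_ Er r1]] := root_field_irrational rL dL.
have [r' [_ Er' r1']] := root_field_irrational rL' dL.
have [d2 _ _] := rL; have [/(_ r)[e [c rE]] free'] := dim2_basis r1' d2.
have c0 : c != 0.
  by apply: contraNneq r1 => c0; apply/mem1P; exists e; rewrite rE c0 scale0r mul0r addr0.
have Q' : r' ^+ 2 = - (be'%:A * r') - ga'%:A.
  by rewrite -[LHS]subr0 -Er' /binary_form scale1r; ring.
(* With r = e + c r', the equation of r is reduced by that of r'; the coefficients of 1 and r' must
   vanish. *)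
have [] := free' (e ^+ 2 + be * e + ga - c ^+ 2 * ga') (c * (2%:R * e + be - c * be')).
  rewrite -Er /binary_form rE scale1r -!in_algE.
  rewrite !(rmorphB, rmorphD, rmorphM, rmorphXn, rmorph_nat) /= !scale1r.
  transitivity (e%:A ^+ 2 + be%:A * e%:A + ga%:A
    + (c%:A * (2%:R * e%:A + be%:A)) * r' + c%:A ^+ 2 * r' ^+ 2).
    by rewrite Q'; ring.
  by ring.
move/eqP; rewrite subr_eq0 => /eqP E2 /eqP; rewrite mulf_eq0 (negPf c0) subr_eq0 => /eqP E1.
by exists c, e.
Qed.

End RootField.

(** * The classification *)

Section Classification.
Variable k : fieldType.
Implicit Types (b c : pairT k) (x y : VT k) (L : fieldExtType k).

Definition pf_root_field b := root_field (pf_al b) (pf_be b) (pf_ga b).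

(** The morphism f covers isotropy over k and over an extension at once. *)
Lemma isotropic_act (R : fieldType) (f : {rmorphism k -> R}) g h b :
  Lam2L2 b -> g \in unitmx -> h \in unitmx ->
  isotropic (f (pf_al (act_Lam2_L2 g h b))) (f (pf_be (act_Lam2_L2 g h b)))
    (f (pf_ga (act_Lam2_L2 g h b))) ->
  isotropic (f (pf_al b)) (f (pf_be b)) (f (pf_ga b)).
Proof.
move=> ab; rewrite !unitmxE !unitfE => dg dh.
rewrite pf_al_act // pf_be_act // pf_ga_act // /binary_form.
rewrite !(rmorphM, rmorphD, rmorphXn, rmorph_nat) /= => iso.
apply: (@isotropic_subst _ _ _ _ (f (\det g)) (f (h 0 0)) (f (h 0 1)) (f (h 1 0)) (f (h 1 1))).
- by rewrite fmorph_eq0.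
- rewrite -!rmorphM -rmorphB fmorph_eq0; by rewrite -det_mx22.
by move: iso; rewrite ?rmorph1.
Qed.

Lemma pf_root_field_orbit b c L : Lam2L2 b -> orbit_Lam2L2 b c ->
  pf_root_field b L -> pf_root_field c L.
Proof.
move=> ab bc [d2 isoL isok]; have [g [h [ug uh cE]]] := bc.
have ac : Lam2L2 c by rewrite cE; apply: act_Lam2L2.
have [g' [h' [ug' uh' bE]]] := orbit_Lam2L2_sym bc.
(* Isotropy over L is carried from b to c, isotropy over k from c back to b, hence the need for
   group elements in both directions. *)
split=> // [|isoc].
  by apply: (isotropic_act (f := in_alg L) ac ug' uh'); rewrite -bE.
by apply: isok; apply: (isotropic_act (f := idfun) ab ug uh); rewrite -cE.
Qed.

Lemma generated_by_pfaffian_roots b L : P2 b != 0 ->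
  generated_by_roots (pfaffian_form b) L <-> pf_root_field b L.
Proof.
rewrite P2E => D0; apply: generated_by_rootsE => // v; exact: pfaffian_formE.
Qed.

Lemma Lam2L2_ss_orbit b c : Lam2L2_ss b -> orbit_Lam2L2 b c -> Lam2L2_ss c.
Proof.
move=> [ab p2] [g [h [ug uh ->]]]; split; first exact: act_Lam2L2.
by rewrite P2_act // mulf_neq0 // expf_neq0 // mulf_neq0 // -unitfE -unitmxE.
Qed.

Lemma U_ss x : U x -> Lam2L2_ss x.2.
Proof. by case/UE => ax p2 _; split. Qed.

Lemma orbit_V_snd x y : orbit_V x y -> orbit_Lam2L2 x.2 y.2.
Proof. by move=> [g [h1 [h2 [ug _ uh ->]]]]; exists g, h2. Qed.

(** Both injectivity claims rest on this: [root_field_affine] relates the standard forms of x and y,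
    and [move_standard] realizes that substitution in the group. *)
Lemma same_field_orbit_V x y L : U x -> U y ->
  pf_root_field x.2 L -> pf_root_field y.2 L -> orbit_V x y.
Proof.
move=> Ux Uy rx ry.
have [x' [be [ga [xx' Ux' sx']]]] := exists_standard Ux.
have [y' [be' [ga' [yy' Uy' sy']]]] := exists_standard Uy.
have rf z z' (b1 c1 : k) : U z -> orbit_V z z' -> standard z' b1 c1 ->
    pf_root_field z.2 L -> root_field 1 b1 c1 L.
  move=> /UE[az _ _] zz' [E1 E2 E3 _ _] rz.
  by rewrite -E1 -E2 -E3; apply: pf_root_field_orbit (orbit_V_snd zz') rz.
have disc z (b1 c1 : k) : U z -> standard z b1 c1 -> b1 ^+ 2 - 4%:R * c1 != 0.
  by move=> /UE[_ p2 _] [E1 E2 E3 _ _]; move: p2; rewrite P2E E1 E2 E3 mulr1.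
have [c [e [c0 E1 E2]]] := root_field_affine (disc _ _ _ Ux' sx') (disc _ _ _ Uy' sy')
  (rf _ _ _ _ Ux xx' sx' rx) (rf _ _ _ _ Uy yy' sy' ry).
have [z [x'z Uz sz]] := move_standard e c0 Ux' sx'.
have {}sz : standard z be' ga'.
  by move: sz; rewrite E1 E2 mulrAC divff // mul1r mulrAC divff ?expf_neq0 // mul1r.
apply: orbit_V_trans xx' _; apply: orbit_V_trans x'z _.
by apply: orbit_V_trans (standard_orbit Uz Uy' sz sy') (orbit_V_sym yy').
Qed.

Lemma same_field_orbit b c L : Lam2L2_ss b -> Lam2L2_ss c ->
  pf_root_field b L -> pf_root_field c L -> orbit_Lam2L2 b c.
Proof.
move=> /exists_U[a Ua] /exists_U[a' Ua'] rb rc.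
exact: (orbit_V_snd (same_field_orbit_V Ua Ua' rb rc)).
Qed.

Lemma exists_pfaffian_form (be ga : k) : exists b,
  [/\ Lam2L2 b, pf_al b = 1, pf_be b = be & pf_ga b = ga].
Proof.
(* Here v_1 B_1 + v_2 B_2 has Pfaffian v_1 (v_1 + be v_2) + ga v_2^2. *)
exists [ffun i => if i == 0 then skew4 1 0 0 0 0 1 else skew4 0 (- ga) 0 0 1 be].
rewrite /pf_al /pf_be /pf_ga /pfpolar /Pfaffian !ffunE /= !addmxE !skew4E /=.
by split; [elim/ord2P; rewrite ffunE; apply: skew4_alternating | ring..].
Qed.

Lemma root_field_classE b L : Lam2L2_ss b -> pf_root_field b L ->
  root_field_class (orbit_Lam2L2 b) = ext_isom L.
Proof.
move=> ssb rb; apply/funext => L'; apply/propext; split=> [[c bc]|LL'].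
  have [ac p2c] := Lam2L2_ss_orbit ssb bc.
  rewrite generated_by_pfaffian_roots // => rc.
  by apply: root_field_unique rb _; apply: pf_root_field_orbit (orbit_Lam2L2_sym bc) rc.
exists b; first exact: orbit_Lam2L2_refl.
by apply/generated_by_pfaffian_roots; [case: ssb | apply: root_field_isom rb].
Qed.

End Classification.

Theorem proposition8p4 (k : fieldType) :
  set_bij (@U_orbits k) (@ss_orbits k) (@B_orbit k) /\
  bij_on (@ss_orbits k) (@Ex2 k) (@root_field_class k).
Proof.
split; split.
- move=> _ [x Ux <-]; rewrite B_orbit_V; exists x.2 => //; exact: U_ss.
- move=> O O' /set_mem[x Ux <-] /set_mem[y Uy <-]; rewrite !B_orbit_V => xy.
  (* A root field of [x.2] is one of [y.2] as well, because their orbits agree. *)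
  have [L rx] := root_field_exists (pf_al x.2) (pf_be x.2) (pf_ga x.2).
  have [ax _] := U_ss Ux; apply: orbit_V_eq; apply: (same_field_orbit_V Ux Uy rx).
  by apply: pf_root_field_orbit ax _ rx; rewrite xy; apply: orbit_Lam2L2_refl.
- move=> _ [b ssb <-]; have [a Ua] := exists_U ssb.
  by exists (orbit_V (a, b)); [exists (a, b) | rewrite B_orbit_V].
- move=> _ [b ssb <-]; have [L rb] := root_field_exists (pf_al b) (pf_be b) (pf_ga b).
  exists L; last exact: root_field_classE.
  by apply: root_field_separable rb; case: ssb; rewrite P2E.
- move=> _ _ [b ssb <-] [c ssc <-] bc; apply: orbit_Lam2L2_eq.
  have [L rb] := root_field_exists (pf_al b) (pf_be b) (pf_ga b).
  have : root_field_class (orbit_Lam2L2 b) L.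
    by exists b; [apply: orbit_Lam2L2_refl | apply/generated_by_pfaffian_roots; case: ssb].
  rewrite bc => -[d cd]; have [ad p2d] := Lam2L2_ss_orbit ssc cd.
  rewrite generated_by_pfaffian_roots // => rd.
  apply: (same_field_orbit ssb ssc rb).
  by apply: pf_root_field_orbit (orbit_Lam2L2_sym cd) rd.
- move=> _ [L sepL ->]; have [be [ga [D0 rL]]] := separable_root_field sepL.
  have [b [ab E1 E2 E3]] := exists_pfaffian_form be ga.
  have ssb : Lam2L2_ss b by split=> //; rewrite P2E E1 E2 E3 mulr1.
  exists (orbit_Lam2L2 b); first by exists b.
  by apply: root_field_classE => //; rewrite /pf_root_field E1 E2 E3.
Qed.
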